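(* For any $0<a,\alpha,t,\delta<\infty$ there exist constants $H^*(a,\alpha,t,\delta)>0$ and $C=C(a,\alpha,t,\delta)$ such that for every soft constraint model: if $\|H\|\le H^*(a,\alpha,t,\delta)$ and $G=(V,E)$ is any graph on $n$ vertices satisfying $$\forall v\in V,\ t(v,a\log n)\le t,\qquad m_\alpha(G,a\log n)<\delta\log n,$$ then the mixing time of the Gibbs sampler of the model on $G$ is $O(n^{C})$.
   Context: For a graph $G=(V,E)$ with graph distance $d(\cdot,\cdot)$, $v\in V$ and $l\ge0$, let $B(v,l)$ be the subgraph induced on $V(v,l)=\{u:d(u,v)\le l\}$. The tree excess of a graph $F=(V_F,E_F)$ is $t(F)=|E_F|-|V_F|+1$, and $t(v,l)=t(B(v,l))$. A path is self-avoiding if its vertices are distinct. For $\alpha>0$ the maximal path $\alpha$-weight is $$m_\alpha(G,l)=\max_\Gamma\sum_{u\in\Gamma}\ \sum_{v\in V,\,v\ne u}\alpha^{d(u,v)},$$ the maximum being over all self-avoiding paths $\Gamma$ in $G$ of length at most $l$ (with $\alpha^{d(u,v)}=0$ if $u,v$ are in different components). Soft constraint model: let $\mathcal C$ be a finite set of states, $h:\mathcal C\to\mathbb R$ (activity function) and $g:\mathcal C^2\to\mathbb R$ a symmetric function (interaction function, taking only finite values). On $G$ the Hamiltonian is $H(\sigma)=\sum_{u\in V}h(\sigma(u))+\sum_{(u,v)\in E}g(\sigma(u),\sigma(v))$ for $\sigma\in\mathcal C^V$, and the model is the probability distribution $P(\sigma)=\frac1Z\exp(H(\sigma))$ on $\mathcal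 C^V$. The norm is $\|H\|=\max\{\max_{x}|h(x)|,\max_{x,y}|g(x,y)|\}$. Gibbs sampler: the discrete time Markov chain on $\mathcal C^V$ in which, from the current configuration $\sigma$, a vertex $v\in V$ is chosen uniformly at random, $\sigma(w)$ is kept for all $w\ne v$, and the new value at $v$ is $x\in\mathcal C$ with probability proportional to $\exp\big(h(x)+\sum_{w:(v,w)\in E}g(\sigma(w),x)\big)$. The mixing time is the number of steps needed to guarantee that the chain, started from an arbitrary state, is within total variation distance $(2e)^{-1}$ of the stationary distribution. The constant implied in $O(n^C)$ does not depend on $n$ or $G$. *)

(* Defs.v *)
From HB Require Import structures.
From mathcomp Require Import all_boot all_order all_algebra.
From mathcomp Require Import boolp classical_sets reals constructive_ereal ereal sequences exp.
From mathcomp Require Import ring lra.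

Set Implicit Arguments.
Unset Strict Implicit.
Unset Printing Implicit Defensive.

Import Order.TTheory GRing.Theory Num.Theory.
Local Open Scope ring_scope.

(* A finite simple graph is a symmetric irreflexive [e : rel V] on a finType. *)

Definition has_walk (V : finType) (e : rel V) (u v : V) (k : nat) : bool :=
  [exists p : k.-tuple V, path e u p && (last u p == v)].

(* A shortest walk has fewer than #|V| edges, so the search range is large
   enough (see gdistP).  The value is #|V| when u and v lie in different
   components; connectedness is always tested separately below. *)
Definition gdist (V : finType) (e : rel V) (u v : V) : nat :=
  find (has_walk e u v) (iota 0 #|V|).

Lemma gdistP (V : finType) (e : rel V) (u v : V) : connect e u v ->
  has_walk e u v (gdist e u v) /\
  (forall k, has_walk e u v k -> (gdist e u v <= k)%N).
Proof.
move=> /connectP[p0 e0 ->]; case: (shortenP e0) => p ep Up _.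
have wp : has_walk e u (last u p) (size p).
  by apply/existsP; exists (in_tuple p); rewrite /= ep eqxx.
have szp : (size p < #|V|)%N by rewrite -[(size p).+1]/(size (u :: p)) -(card_uniqP Up) max_card.
have hs : has (has_walk e u (last u p)) (iota 0 #|V|).
  by apply/hasP; exists (size p) => //; rewrite mem_iota.
have lt_d : (gdist e u (last u p) < #|V|)%N.
  by rewrite -[X in (_ < X)%N](size_iota 0) -has_find.
split=> [|k wk].
  by have := nth_find 0%N hs; rewrite nth_iota.
rewrite leqNgt; apply/negP => lt_k.
have := before_find 0%N lt_k.
by rewrite nth_iota ?wk // (ltn_trans lt_k).
Qed.

Definition ball_vertices (R : realType) (V : finType) (e : rel V) (v : V)
    (l : R) : {set V} :=
  [set u | connect e u v & (gdist e u v)%:R <= l].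

Definition induced_edges (V : finType) (e : rel V) (A : {set V}) :
    {set {set V}} :=
  [set [set x; y] | x in A, y in A & e x y].

Definition tree_excess (V : finType) (e : rel V) (A : {set V}) : int :=
  #|induced_edges e A|%:Z - #|A|%:Z + 1.

Definition dist_weight (R : realType) (V : finType) (e : rel V) (alpha : R)
    (u v : V) : R :=
  if connect e u v then alpha ^+ gdist e u v else 0.

(* A self-avoiding path is given by its nonempty duplicate-free sequence of
   vertices, which has at most #|V| entries; its length is its number of
   edges, (size p).-1.  For 0 <= alpha all path weights are nonnegative, so the
   neutral element 0 of the iterated maximum is harmless. *)
Definition max_path_weight (R : realType) (V : finType) (e : rel V)
    (alpha l : R) : R :=
  \big[Num.max/0]_(p : #|V|.-bseq V
      | [&& p != [::] :> seq V, sorted e p, uniq p & (size p).-1%:R <= l])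
    \sum_(u <- p) \sum_(v | v != u) dist_weight e alpha u v.

(* Every undirected edge occurs as two ordered pairs, whence the factor 1/2;
   this is the sum over edges because g is assumed symmetric. *)
Definition hamiltonian (R : realType) (V : finType) (e : rel V) (S : finType)
    (h : S -> R) (g : S -> S -> R) (s : {ffun V -> S}) : R :=
  \sum_u h (s u) + 2^-1 * \sum_u \sum_(v | e u v) g (s u) (s v).

Definition gibbs_measure (R : realType) (V : finType) (e : rel V)
    (S : finType) (h : S -> R) (g : S -> S -> R) (s : {ffun V -> S}) : R :=
  expR (hamiltonian e h g s) /
  \sum_(s' : {ffun V -> S}) expR (hamiltonian e h g s').

Definition hamiltonian_norm (R : realType) (S : finType) (h : S -> R)
    (g : S -> S -> R) : R :=
  Num.max (\big[Num.max/0]_x `|h x|)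
          (\big[Num.max/0]_x \big[Num.max/0]_y `|g x y|).

Definition update (V S : finType) (s : {ffun V -> S}) (v : V) (x : S) :
    {ffun V -> S} :=
  [ffun w => if w == v then x else s w].

Definition heat_bath_weight (R : realType) (V : finType) (e : rel V)
    (S : finType) (h : S -> R) (g : S -> S -> R) (s : {ffun V -> S}) (v : V)
    (x : S) : R :=
  expR (h x + \sum_(w | e v w) g (s w) x).

Definition gibbs_sampler (R : realType) (V : finType) (e : rel V)
    (S : finType) (h : S -> R) (g : S -> S -> R) (s s' : {ffun V -> S}) : R :=
  \sum_v #|V|%:R^-1 *
    \sum_(x | update s v x == s')
      heat_bath_weight e h g s v x / \sum_y heat_bath_weight e h g s v y.

Definition chain_law (R : realType) (T : finType) (P : T -> T -> R) (s : T)
    (k : nat) : T -> R :=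
  iter k (fun mu s2 => \sum_s1 mu s1 * P s1 s2) (fun s1 => (s1 == s)%:R).

Definition total_variation (R : realType) (T : finType) (mu nu : T -> R) : R :=
  2^-1 * \sum_s `|mu s - nu s|.

Definition mixing_time (R : realType) (T : finType) (P : T -> T -> R)
    (pi : T -> R) : \bar R :=
  ereal_inf [set k%:R%:E | k in [set k : nat |
    forall s, total_variation (chain_law P s k) pi <= (2 * expR 1)^-1]]%classic.

Lemma hamiltonian_split (R : realType) (V : finType) (e : rel V) (S : finType)
    (h : S -> R) (g : S -> S -> R) (s : {ffun V -> S}) (v : V) (x : S) :
  symmetric e -> irreflexive e -> (forall y z, g y z = g z y) ->
  hamiltonian e h g (update s v x) =
    h x + \sum_(w | e v w) g (s w) x +
    (\sum_(u | u != v) h (s u) +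
     2^-1 * \sum_(u | u != v) \sum_(w | e u w && (w != v)) g (s u) (s w)).
Proof.
move=> esym eirr gsym; rewrite /hamiltonian.
have uv : update s v x v = x by rewrite ffunE eqxx.
have uN w : w != v -> update s v x w = s w by rewrite ffunE => /negbTE ->.
rewrite (bigD1 v) //= uv; under eq_bigr => u /uN -> do [].
rewrite [in X in _ + 2^-1 * X](bigD1 v) //= uv.
have -> : \sum_(w | e v w) g x (update s v x w) = \sum_(w | e v w) g (s w) x.
  apply: eq_bigr => w evw; rewrite uN 1?gsym //.
  by apply: contraTneq evw => ->; rewrite eirr.
have -> : \sum_(u | u != v) \sum_(w | e u w) g (update s v x u) (update s v x w)
    = \sum_(u | u != v) (if e v u then g (s u) x else 0) +
      \sum_(u | u != v) \sum_(w | e u w && (w != v)) g (s u) (s w).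
  rewrite -big_split /=; apply: eq_bigr => u uv'; rewrite uN // esym.
  rewrite (bigID (pred1 v)) /= addrC [RHS]addrC; congr (_ + _).
    by apply: eq_bigr => w /andP[_ wv]; rewrite uN.
  case: ifPn => [euv|neuv].
    rewrite (big_pred1 v) ?uv // => w /=.
    by case: eqP => [->|]; rewrite ?euv ?andbF.
  by rewrite big1 // => w /andP[euw /eqP wv]; rewrite wv (negbTE neuv) in euw.
have -> : \sum_(u | u != v) (if e v u then g (s u) x else 0)
    = \sum_(w | e v w) g (s w) x.
  rewrite -big_mkcondr; apply: eq_bigl => w.
  by case: eqP => [->|]; rewrite ?eirr.
by lra.
Qed.

(* The distance to [gibbs_measure] in the mixing time of [gibbs_sampler] is
   indeed the distance to the stationary distribution. *)
Lemma gibbs_stationary (R : realType) (V : finType) (e : rel V) (S : finType)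
    (h : S -> R) (g : S -> S -> R) (s' : {ffun V -> S}) :
  symmetric e -> irreflexive e -> (forall y z, g y z = g z y) ->
  (0 < #|V|)%N ->
  \sum_s gibbs_measure e h g s * gibbs_sampler e h g s s' =
  gibbs_measure e h g s'.
Proof.
move=> esym eirr gsym V0; rewrite /gibbs_measure /gibbs_sampler.
set Z := \sum_s expR _.
under eq_bigr => s _ do rewrite mulr_sumr.
rewrite exchange_big /=.
have upK (s : {ffun V -> S}) v y x : update (update s v y) v x = update s v x.
  by apply/ffunP => w; rewrite !ffunE; case: eqP.
have upid (s : {ffun V -> S}) v : update s v (s v) = s.
  by apply/ffunP => w; rewrite ffunE; case: eqP => [->|].
have wtE s v y x : heat_bath_weight e h g (update s v y) v x =
    heat_bath_weight e h g s v x.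
  congr (expR (_ + _)); apply: eq_bigr => w evw; rewrite ffunE ifN //.
  by apply: contraTneq evw => ->; rewrite eirr.
suff step v : \sum_s expR (hamiltonian e h g s) / Z * (#|V|%:R^-1 *
    \sum_(x | update s v x == s') heat_bath_weight e h g s v x /
      \sum_y heat_bath_weight e h g s v y)
    = #|V|%:R^-1 * (expR (hamiltonian e h g s') / Z).
  under eq_bigr => v _ do rewrite step.
  by rewrite sumr_const -[LHS]mulr_natl mulrA divff ?mul1r // pnatr_eq0 -lt0n.
set W := \sum_y heat_bath_weight e h g s' v y.
have Wn0 : W != 0.
  rewrite gt_eqF // /W (bigD1 (s' v)) //= ltr_pwDl ?expR_gt0 //.
  by apply: sumr_ge0 => y _; apply: expR_ge0.
pose F := expR (\sum_(u | u != v) h (s' u) +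
     2^-1 * \sum_(u | u != v) \sum_(w | e u w && (w != v)) g (s' u) (s' w)).
have HE y : expR (hamiltonian e h g (update s' v y)) =
    heat_bath_weight e h g s' v y * F.
  by rewrite hamiltonian_split // expRD.
transitivity (\sum_(s | update s v (s' v) == s')
   expR (hamiltonian e h g s) / Z * (#|V|%:R^-1 *
     (heat_bath_weight e h g s v (s' v) / \sum_y heat_bath_weight e h g s v y))).
  rewrite [RHS]big_mkcond; apply: eq_bigr => s _; case: ifPn => hs.
    rewrite (big_pred1 (s' v)) // => x /=; apply/eqP/eqP => [<-|->].
      by rewrite ffunE eqxx.
    exact/eqP.
  rewrite big1 ?mulr0 // => x /eqP hx; case/negP: hs.
  have -> : s' v = x by rewrite -hx ffunE eqxx.
  exact/eqP.
rewrite (reindex (update s' v)) /=; last first.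
  exists (fun s => s v) => [y _|s]; first by rewrite ffunE eqxx.
  by rewrite inE => /eqP <-; rewrite upK upid.
transitivity (\sum_y heat_bath_weight e h g s' v y *
   (F / Z * (#|V|%:R^-1 * (heat_bath_weight e h g s' v (s' v) / W)))).
  apply: eq_big => [y|y _]; first by rewrite upK upid eqxx.
  rewrite HE wtE; under eq_bigr => z _ do rewrite wtE.
  by rewrite -!mulrA.
rewrite -mulr_suml -/W -[in RHS](upid s' v) HE.
by move: (heat_bath_weight _ _ _ _ _ _) (_^-1) (_^-1) => w b z; field.
Qed.

(* Main.v *)
From mathcomp Require Import boolp classical_sets reals constructive_ereal ereal sequences exp.
From mathcomp Require Import all_boot all_order all_algebra.
From mathcomp Require Import ring lra.
Require Import Defs.

Set Implicit Arguments.
Unset Strict Implicit.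
Unset Printing Implicit Defensive.

Import Order.TTheory GRing.Theory Num.Theory.
Local Open Scope ring_scope.

(** Write [w] for the Gibbs weight, n for the number of vertices, l for a ln n and
    V_A(f) for the mean conditional variance [bvar w A f] of f on the block A.  It
    is enough to prove a Poincare inequality

      Var f <= n^O(1) sum_v V_{v}(f),

    because the transition operator of the Gibbs sampler is the mean of the
    orthogonal projections [ce w [set v]] and the smallest stationary probability
    is at least exp(- O(n^2)) ([mixing_time_bound]).  The inequality is first
    proved inside balls of radius l, and then transferred to the whole graph.

    Inside a ball ([bvar_ball]).  If m edges join the disjoint blocks B and D,
    deleting these edges changes the weight by a factor exp(beta m) at most, and
    then B and D are independent given the rest, whence
    V_{B u D} <= exp(2 beta m) (V_B + V_D) ([bvar_split]).  In the breadth-first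
    tree of the ball, a subtree is joined to the other vertices by one tree edge
    and at most t other edges, so cutting it off costs a factor
    exp(2 beta (t + 1)).  Cutting off the subtrees of the children, recursively from
    the root, costs exp(2 beta (t + 1) D), where D is the maximal sum of the degrees
    along a path from the root.  Such a path is self-avoiding of length at most l,
    so alpha D <= m_alpha(G, l) < delta ln n and the price is a power of n.

    Decay of correlations ([site_decay]).  Resample a ball of centre v under two
    boundary conditions, independently, and expand the product over the edges of
    the weights of the pair of configurations into sets of open edges.  When the
    open cluster of v does not leave the ball, the two copies can be exchanged on
    the cluster, so only the other sets contribute to the difference of the laws of
    the spin at v.  For them a self-avoiding path of more than l steps from v is
    open.  A fixed path is open with weight at most rho^l, where rho is small with
    beta, and there are at most exp(delta ln n / alpha) = n^(delta / alpha) paths,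
    since the product of the degrees along a path is at most the exponential of
    their sum ([size_saws]).  Hence the influence of the boundary is
    at most 2 n^(-6) when beta is small enough.

    From balls to the graph ([poincare]).  Order the vertices v_1, ..., v_n and
    resample in turn the blocks B_i = ball(v_i) minus {v_1, ..., v_(i-1)}.  By decay
    of correlations the spin at v_i hardly depends on the starting configuration,
    and it is not touched later; so the final configuration is nearly independent
    of the start, and by Schur's test the operator P of this scan satisfies
    |P f| <= |f| / 2 in L2 when f is centred.  On the other hand
    |f - P f|^2 <= sum_i V_{B_i}(f), since P is a composition of orthogonal
    projections.  Therefore |f|^2 <= 4 sum_i V_{B_i}(f). *)

(** * Block conditional expectations *)

Section Blocks.
Variables (R : realType) (V S : finType).
Local Notation Om := {ffun V -> S}.
Implicit Types (A B D : {set V}) (s t : Om) (w f m : Om -> R).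

(** The configuration [s] with its values on the block [A] replaced by those
    of [t].  Two configurations agree off [A] iff one is a [mix A] of the other. *)
Definition mix A s t : Om := [ffun u => if u \in A then t u else s u].

Lemma mixK A s t : mix A (mix A s t) (mix A t s) = s.
Proof. by apply/ffunP => u; rewrite !ffunE; case: (u \in A). Qed.

Lemma mix_mixl A s t r : mix A (mix A s t) r = mix A s r.
Proof. by apply/ffunP => u; rewrite !ffunE; case: (u \in A). Qed.

Lemma mixU B D s t : mix (B :|: D) s t = mix B (mix D s t) t.
Proof. by apply/ffunP => u; rewrite !ffunE inE; case: (u \in B). Qed.

Lemma mixC B D s t r : [disjoint B & D] ->
  mix B (mix D s t) r = mix D (mix B s r) t.
Proof.
move=> dBD; apply/ffunP => u; rewrite !ffunE; case: ifP => // uB.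
by rewrite (disjointFr dBD uB).
Qed.

(** Exchanging the values on [A] is an involution on pairs of configurations. *)
Lemma sum_mix_swap A (F : Om -> Om -> R) :
  \sum_s \sum_t F s t = \sum_s \sum_t F (mix A s t) (mix A t s).
Proof.
rewrite !pair_bigA /=.
rewrite (reindex_inj (h := fun p : Om * Om => (mix A p.1 p.2, mix A p.2 p.1))) //.
by apply: (can_inj (g := fun p => (mix A p.1 p.2, mix A p.2 p.1))) => -[s t] /=;
  rewrite !mixK.
Qed.

(** The normalising constant of the law of the block [A] given [s] off [A].  The
    sum runs over all configurations [t], so that each value on [A] is counted
    once for every choice of [t] off [A]; this factor cancels in [ce]. *)
Definition blocknorm w A s : R := \sum_t w (mix A s t).

(** Conditional expectation of [f] given the configuration off [A], under the
    probability measure proportional to the weight [w]. *)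
Definition ce w A f s : R :=
  (\sum_t w (mix A s t) * f (mix A s t)) / blocknorm w A s.

(** The mean conditional variance of [f] given the configuration off [A], up to
    the normalisation of [w]. *)
Definition bvar w A f : R := \sum_s w s * (f s - ce w A f s) ^+ 2.

(** [m] depends only on the values off [A]. *)
Definition offm A m := forall s t, m (mix A s t) = m s.

Lemma offmW A B m : B \subset A -> offm A m -> offm B m.
Proof.
move=> sBA mA s t; rewrite -(mA s t) -(mA (mix B s t) t); congr m.
apply/ffunP => u; rewrite !ffunE; case: ifP => // uA.
by rewrite (contraFF (subsetP sBA u) uA).
Qed.

Lemma offmU B D m : offm B m -> offm D m -> offm (B :|: D) m.
Proof. by move=> mB mD s t; rewrite mixU mB mD. Qed.

Lemma eq_ce w A f g : f =1 g -> ce w A f =1 ce w A g.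
Proof. by move=> fg s; rewrite /ce; congr (_ / _); apply: eq_bigr => t _; rewrite fg. Qed.

Section Weight.
Variable w : Om -> R.
Hypothesis w_gt0 : forall s, 0 < w s.

Lemma w_ge0 s : 0 <= w s. Proof. exact: ltW. Qed.

Lemma blocknorm_gt0 A s : 0 < blocknorm w A s.
Proof.
rewrite /blocknorm (bigD1 s) //= ltr_pwDl //.
by apply: sumr_ge0 => t _; exact: w_ge0.
Qed.

Lemma blocknorm_neq0 A s : blocknorm w A s != 0.
Proof. by rewrite gt_eqF ?blocknorm_gt0. Qed.

Lemma blocknorm_off A : offm A (blocknorm w A).
Proof. by move=> s t; apply: eq_bigr => r _; rewrite mix_mixl. Qed.

Lemma ce_off A f : offm A (ce w A f).
Proof.
move=> s t; rewrite /ce blocknorm_off; congr (_ / _).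
by apply: eq_bigr => r _; rewrite mix_mixl.
Qed.

Lemma ce_sum (I : Type) (r : seq I) A (c : I -> R) (G : I -> Om -> R) s :
  ce w A (fun t => \sum_(i <- r) c i * G i t) s = \sum_(i <- r) c i * ce w A (G i) s.
Proof.
rewrite /ce; under eq_bigr => t _ do rewrite mulr_sumr.
rewrite exchange_big /= mulr_suml; apply: eq_bigr => i _.
by rewrite mulrA mulr_sumr; congr (_ / _); apply: eq_bigr => t _; ring.
Qed.

Lemma ceB A f g s : ce w A (fun t => f t - g t) s = ce w A f s - ce w A g s.
Proof.
rewrite /ce -mulrBl -sumrB; congr (_ / _).
by apply: eq_bigr => t _; ring.
Qed.

Lemma ce_id A m s : offm A m -> ce w A m s = m s.
Proof.
move=> mA; rewrite /ce; under eq_bigr => t _ do rewrite mA.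
by rewrite -mulr_suml mulrAC mulfV ?mul1r // blocknorm_neq0.
Qed.

Lemma ce_ge A f s c : (forall t, c <= f (mix A s t)) -> c <= ce w A f s.
Proof.
move=> cf; rewrite /ce ler_pdivlMr ?blocknorm_gt0 // /blocknorm mulr_sumr.
by apply: ler_sum => t _; rewrite mulrC ler_wpM2l // w_ge0.
Qed.

Lemma ce_le A f s c : (forall t, f (mix A s t) <= c) -> ce w A f s <= c.
Proof.
move=> cf; rewrite /ce ler_pdivrMr ?blocknorm_gt0 // /blocknorm mulr_sumr.
by apply: ler_sum => t _; rewrite mulrC ler_wpM2r // w_ge0.
Qed.

(** [ce w A] is the orthogonal projection, in the L2 space of [w], onto the
    functions that depend only on the values off [A]. *)
Lemma ce_orth A f m : offm A m ->
  \sum_s w s * (ce w A f s * m s) = \sum_s w s * (f s * m s).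
Proof.
move=> mA.
transitivity (\sum_s \sum_t w s * m s * (w (mix A s t) * f (mix A s t)) / blocknorm w A s).
  apply: eq_bigr => s _; rewrite /ce -mulr_suml -mulr_sumr; ring.
rewrite (sum_mix_swap A); apply: eq_bigr => s _.
under eq_bigr => t _ do rewrite mixK mA blocknorm_off.
have -> : \sum_t w (mix A s t) * m s * (w s * f s) / blocknorm w A s
   = w s * (f s * m s) * (blocknorm w A s / blocknorm w A s).
  by rewrite -!mulr_suml /blocknorm; ring.
by rewrite mulfV ?mulr1 ?blocknorm_neq0.
Qed.

Lemma ce_mean A f : \sum_s w s * ce w A f s = \sum_s w s * f s.
Proof.
have := @ce_orth A f (fun=> 1) (fun _ _ => erefl).
under eq_bigr do rewrite mulr1.
by under [in RHS]eq_bigr do rewrite mulr1.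
Qed.

Lemma pythagoras A f m : offm A m ->
  \sum_s w s * (f s - m s) ^+ 2 =
  bvar w A f + \sum_s w s * (ce w A f s - m s) ^+ 2.
Proof.
move=> mA; rewrite /bvar -big_split /=.
have h : \sum_s w s * (ce w A f s * (ce w A f s - m s)) =
   \sum_s w s * (f s * (ce w A f s - m s)).
  by apply: ce_orth => s t; rewrite ce_off mA.
apply/eqP; rewrite -subr_eq0 -sumrB; apply/eqP.
transitivity (2 * (\sum_s w s * (f s * (ce w A f s - m s)) -
   \sum_s w s * (ce w A f s * (ce w A f s - m s)))); last by rewrite h subrr mulr0.
rewrite -sumrB mulr_sumr; apply: eq_bigr => s _; ring.
Qed.

Lemma bvar_ge0 A f : 0 <= bvar w A f.
Proof. by apply: sumr_ge0 => s _; rewrite mulr_ge0 ?w_ge0 ?sqr_ge0. Qed.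

Lemma bvar_min A f m : offm A m -> bvar w A f <= \sum_s w s * (f s - m s) ^+ 2.
Proof.
move=> mA; rewrite (pythagoras f mA) lerDl.
by apply: sumr_ge0 => s _; rewrite mulr_ge0 ?w_ge0 ?sqr_ge0.
Qed.

Lemma bvar_mono A B f : B \subset A -> bvar w B f <= bvar w A f.
Proof. by move=> sBA; apply/bvar_min/(offmW sBA)/ce_off. Qed.

Lemma ce_contr A f : \sum_s w s * ce w A f s ^+ 2 <= \sum_s w s * f s ^+ 2.
Proof.
have := @pythagoras A f (fun=> 0) (fun _ _ => erefl).
under eq_bigr do rewrite subr0; under [X in _ + X]eq_bigr do rewrite subr0.
by move=> ->; rewrite lerDr bvar_ge0.
Qed.

(** By orthogonality, squared distances add up along a composition of
    conditional expectations. *)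
Lemma sqnorm_ce_step A f g :
  \sum_s w s * (f s - ce w A g s) ^+ 2 <=
  bvar w A f + \sum_s w s * (f s - g s) ^+ 2.
Proof.
rewrite (pythagoras f (ce_off A g)) lerD2l.
under eq_bigr do rewrite -ceB; exact: ce_contr.
Qed.

End Weight.

(** Tensorization of the variance: the factorization hypothesis says that [B] and
    [D] are conditionally independent under [w], given the rest. *)
Lemma bvar_tensor w B D f : (forall s, 0 < w s) -> [disjoint B & D] ->
  (forall s t r, w (mix B (mix D s r) t) * w s = w (mix B s t) * w (mix D s r)) ->
  bvar w (B :|: D) f <= bvar w B f + bvar w D f.
Proof.
move=> w0 dBD fac.
apply: le_trans (sqnorm_ce_step w0 B f (ce w D f)).
(* Resampling B after D leaves no dependence on D: the law of B given the rest
   does not see D. *)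
apply: bvar_min => //; apply: offmU; first exact: ce_off.
move=> s r.
have Nw u : w u != 0 by rewrite gt_eqF.
have st t : w (mix B (mix D s r) t) = w (mix D s r) / w s * w (mix B s t).
  by apply: (mulIf (Nw s)); rewrite fac; field.
have gD t : ce w D f (mix B (mix D s r) t) = ce w D f (mix B s t).
  by rewrite mixC // ce_off.
move: gD; set g := ce w D f => gD; rewrite /ce /blocknorm.
under eq_bigr => t _ do rewrite st gD -mulrA.
under [in X in _ / X]eq_bigr => t _ do rewrite st.
rewrite -!mulr_sumr invfM mulrACA divff ?mul1r //.
by rewrite mulf_neq0 ?invr_neq0.
Qed.

(** Holley-Stroock comparison. *)
Lemma bvar_compare w w' c A f : (forall s, 0 < w s) -> (forall s, 0 < w' s) ->
  (forall s, w s <= c * w' s) -> bvar w A f <= c * bvar w' A f.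
Proof.
move=> w0 w0' ww'.
apply: le_trans (bvar_min w0 f (ce_off w' A f)) _.
rewrite /bvar mulr_sumr; apply: ler_sum => s _; rewrite mulrA.
by apply: ler_wpM2r; rewrite ?sqr_ge0.
Qed.

End Blocks.

(** * Splitting a block by deleting the edges across *)

Section GibbsBlocks.
Variables (R : realType) (V S : finType) (e : rel V) (h : S -> R) (g : S -> S -> R).
Hypothesis esym : symmetric e.
Variable beta : R.
Hypothesis beta_ge0 : 0 <= beta.
Hypothesis g_le : forall x y, `|g x y| <= beta.
Local Notation Om := {ffun V -> S}.
Implicit Types (A B D : {set V}) (s t r : Om) (f : Om -> R).

(** The unnormalised Gibbs weight. *)
Definition boltz s : R := expR (hamiltonian e h g s).

Lemma boltz_gt0 s : 0 < boltz s. Proof. exact: expR_gt0. Qed.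

(** The edges between [B] and [D], each as the pair starting in [B]. *)
Definition cross_edges B D : {set V * V} :=
  [set p | [&& p.1 \in B, p.2 \in D & e p.1 p.2]].

Let crossing B D u v := (u \in B) && (v \in D) || (u \in D) && (v \in B).

(** The Hamiltonian without the interactions between [B] and [D]. *)
Definition decoupled_ham B D s : R :=
  \sum_u h (s u) + 2^-1 * \sum_u \sum_(v | e u v && ~~ crossing B D u v) g (s u) (s v).

Lemma decoupled_ham_mix B D s t r : [disjoint B & D] ->
  decoupled_ham B D (mix B (mix D s r) t) + decoupled_ham B D s =
  decoupled_ham B D (mix B s t) + decoupled_ham B D (mix D s r).
Proof.
move=> dBD; rewrite /decoupled_ham addrACA [RHS]addrACA -!big_split -!mulrDr -!big_split /=.
congr (_ + _ * _); apply: eq_bigr => u _.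
  rewrite !ffunE; case: ifP => uB; last by rewrite addrC.
  by rewrite (disjointFr dBD uB).
rewrite -!big_split /=; apply: eq_bigr => v /andP[_]; rewrite /crossing !ffunE.
case uB: (u \in B); case uD: (u \in D); case vB: (v \in B); case vD: (v \in D);
  rewrite ?(disjointFr dBD uB) ?(disjointFr dBD vB) //= in uD vD *; by rewrite addrC.
Qed.

Lemma cross_edges_sym B D : #|cross_edges D B| = #|cross_edges B D|.
Proof.
rewrite -(card_imset (cross_edges B D) (can_inj (@swap_pairK V V))).
apply: eq_card => -[u v]; rewrite inE /=; apply/idP/imsetP => [/and3P[uD vB euv]|].
  by exists (v, u) => //; rewrite inE /= vB uD esym.
by move=> [[x y]]; rewrite inE /= => /and3P[xB yD exy] [-> ->]; rewrite yD xB esym.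
Qed.

Lemma decoupled_ham_close B D s :
  `|hamiltonian e h g s - decoupled_ham B D s| <= beta * #|cross_edges B D|%:R.
Proof.
have -> : hamiltonian e h g s - decoupled_ham B D s =
    2^-1 * \sum_u \sum_(v | e u v && crossing B D u v) g (s u) (s v).
  rewrite /hamiltonian /decoupled_ham opprD addrACA subrr add0r -mulrBr -sumrB.
  congr (_ * _); apply: eq_bigr => u _.
  by rewrite (bigID (crossing B D u)) /= addrK.
rewrite normrM ger0_norm ?invr_ge0 // ler_pdivrMl //.
rewrite pair_big_dep /=; apply: le_trans (ler_norm_sum _ _ _) _.
apply: (@le_trans _ _ (\sum_(p : V * V | e p.1 p.2 && crossing B D p.1 p.2) beta)).
  by apply: ler_sum => p _; exact: g_le.
rewrite sumr_const -[X in X <= _]mulr_natr.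
rewrite mulrCA ler_wpM2l // -natrM ler_nat mul2n -addnn -{1}(cross_edges_sym B D).
apply: leq_trans (leq_card_setU _ _); apply/subset_leq_card/subsetP => -[u v].
by rewrite !inE /= => /andP[-> /orP[]/andP[-> ->]]; rewrite ?orbT.
Qed.

(** Deleting the edges between [B] and [D] changes the weight by a factor
    [expR (beta * m)] at most, in both directions, [m] being their number; without
    them [B] and [D] are conditionally independent. *)
Lemma bvar_split B D f : [disjoint B & D] ->
  bvar boltz (B :|: D) f <=
  expR (2 * beta * #|cross_edges B D|%:R) * (bvar boltz B f + bvar boltz D f).
Proof.
move=> dBD; set k := beta * #|cross_edges B D|%:R.
pose w' s := expR (decoupled_ham B D s).
have w'0 s : 0 < w' s by exact: expR_gt0.
have close s := decoupled_ham_close B D s.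
have c1 s : boltz s <= expR k * w' s.
  rewrite -expRD ler_expR; have := close s; rewrite ler_norml /k; lra.
have c2 s : w' s <= expR k * boltz s.
  rewrite -expRD ler_expR; have := close s; rewrite ler_norml /k; lra.
have -> : 2 * beta * #|cross_edges B D|%:R = k + k by rewrite /k; ring.
rewrite expRD -mulrA; apply: le_trans (bvar_compare _ _ boltz_gt0 w'0 c1) _.
rewrite ler_wpM2l ?expR_ge0 // mulrDr.
apply: le_trans (bvar_tensor _ w'0 dBD _) _.
  by move=> s t r; rewrite -!expRD decoupled_ham_mix.
by apply: lerD; apply: bvar_compare => //; exact: boltz_gt0.
Qed.

End GibbsBlocks.

(** * Breadth-first trees in balls *)

Section Tree.
Variables (R : realType) (V : finType) (e : rel V).
Hypotheses (esym : symmetric e) (eirr : irreflexive e).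

Lemma has_walkP u v k :
  reflect (exists p : seq V, [/\ size p = k, path e u p & last u p = v])
          (has_walk e u v k).
Proof.
apply: (iffP existsP) => [[p /andP[ep /eqP lp]]|[p [<- ep <-]]].
  by exists p; rewrite size_tuple.
by exists (in_tuple p); rewrite /= ep eqxx.
Qed.

Lemma gdist_walk u p : path e u p -> (gdist e u (last u p) <= size p)%N.
Proof.
move=> ep; have /gdistP[_] : connect e u (last u p) by apply/connectP; exists p.
by apply; apply/has_walkP; exists p.
Qed.

Lemma gdist_path u v : connect e u v ->
  exists p, [/\ size p = gdist e u v, path e u p & last u p = v].
Proof. by move=> /gdistP[/has_walkP]. Qed.

Lemma gdist0 u : gdist e u u = 0%N.
Proof. by apply/eqP; rewrite -leqn0 -/(size ([::] : seq V)) (@gdist_walk u [::]). Qed.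

Lemma gdist_eq0 u v : connect e u v -> (gdist e u v == 0%N) = (u == v).
Proof.
move=> /gdist_path[p [sz _ lp]]; apply/eqP/eqP => [d0|<-]; last exact: gdist0.
by move: sz lp; rewrite d0 => /size0nil ->.
Qed.

Lemma gdist_edge u v : e u v -> gdist e u v = 1%N.
Proof.
move=> euv; have cuv : connect e u v := connect1 euv.
apply/eqP; rewrite eqn_leq (@gdist_walk u [:: v]) /= ?euv // lt0n gdist_eq0 //.
by apply: contraTneq euv => ->; rewrite eirr.
Qed.

Lemma has_walk_sym u v k : has_walk e u v k -> has_walk e v u k.
Proof.
move=> /has_walkP[p [sz ep lp]]; apply/has_walkP; exists (rev (belast u p)).
rewrite size_rev size_belast sz -lp rev_path; split=> //.
  by rewrite (eq_path (e' := e)) // => x y /=; rewrite esym.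
by case: p {sz ep lp} => //= x p; rewrite rev_cons last_rcons.
Qed.

Lemma gdist_sym u v : gdist e u v = gdist e v u.
Proof. by apply: eq_find => k; apply/idP/idP; apply: has_walk_sym. Qed.

Lemma gdist_pred v u : connect e u v -> u != v ->
  exists x, [/\ e u x, connect e x v & (gdist e x v).+1 = gdist e u v].
Proof.
move=> cuv uv; have [[|x p] [sz /= ep lp]] := gdist_path cuv.
  by rewrite lp eqxx in uv.
case/andP: ep => ex ep; have cx : connect e x v by apply/connectP; exists p.
exists x; split=> //; apply/eqP; rewrite eqn_leq -{1}sz /= ltnS -lp gdist_walk //=.
rewrite lp; have [q [<- eq <-]] := gdist_path cx.
by apply: (@gdist_walk u (x :: q)); rewrite /= ex.
Qed.

Variables (v : V) (l : R).
Hypothesis l_ge0 : 0 <= l.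
Local Notation d u := (gdist e u v).
Local Notation Bv := (ball_vertices e v l).

(** A neighbour of [u] one step closer to the root [v]; [u] itself if there is
    none, in particular for [u = v]. *)
Definition parent u : V :=
  if [pick x | [&& e u x, connect e x v & (gdist e x v).+1 == gdist e u v]]
  is Some x then x else u.

Lemma ball_root : v \in Bv.
Proof. by rewrite inE connect0 gdist0 /= l_ge0. Qed.

Lemma ball_connect u : u \in Bv -> connect e u v.
Proof. by rewrite in_set => /andP[]. Qed.

Lemma parentP u : u \in Bv -> u != v ->
  [/\ e u (parent u), parent u \in Bv & (d (parent u)).+1 = d u].
Proof.
move=> uB uv; rewrite /parent; case: pickP => [x /and3P[-> cx /eqP dx]|no].
  split=> //; rewrite inE cx /=; move: uB; rewrite inE => /andP[_].
  by apply: le_trans; rewrite ler_nat -dx.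
have [x [ex cx dx]] := gdist_pred (ball_connect uB) uv.
by have := no x; rewrite ex cx dx eqxx.
Qed.

Lemma parent_root : parent v = v.
Proof.
by rewrite /parent; case: pickP => [x /and3P[_ _]|//]; rewrite gdist0.
Qed.

Lemma gdist_parent u : u \in Bv -> d (parent u) = (d u).-1 /\ parent u \in Bv.
Proof.
move=> uB; have [->|uv] := eqVneq u v; first by rewrite parent_root gdist0 ball_root.
by have [_ ? <-] := parentP uB uv.
Qed.

Lemma gdist_iter_parent k u : u \in Bv ->
  d (iter k parent u) = (d u - k)%N /\ iter k parent u \in Bv.
Proof.
move=> uB; elim: k => [|k [IHd IHB]] /=; first by rewrite subn0.
by have [-> ->] := gdist_parent IHB; rewrite IHd subnS.
Qed.

(** The vertices of the ball whose path of parents to the root goes through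
    [w]. *)
Definition subtree w : {set V} :=
  [set u in Bv | (d w <= d u)%N && (iter (d u - d w) parent u == w)].

Lemma in_subtree w u : (u \in subtree w) =
  [&& u \in Bv, (d w <= d u)%N & iter (d u - d w) parent u == w].
Proof. by rewrite /subtree in_set. Qed.

Lemma subtree_ball w : subtree w \subset Bv.
Proof. by apply/subsetP => u; rewrite in_subtree => /andP[]. Qed.

Lemma subtree_root : subtree v = Bv.
Proof.
apply/setP => u; rewrite in_subtree; case uB: (u \in Bv) => //=.
rewrite gdist0 leq0n subn0 /=.
have [du iB] := gdist_iter_parent (d u) uB.
by rewrite -gdist_eq0 ?du ?subnn // ball_connect.
Qed.

Lemma subtree_parent w u : u \in subtree w -> u != w -> parent u \in subtree w.
Proof.
rewrite !in_subtree => /and3P[uB dwu /eqP iu] uw.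
have [dp ->] := gdist_parent uB.
have lt : (d w < d u)%N.
  rewrite ltn_neqAle dwu andbT; apply: contraNneq uw => dE.
  by move: iu; rewrite dE subnn /= => ->.
rewrite dp; case: (d u) lt iu => // n; rewrite ltnS /= => le.
by rewrite le -iterSr -subSn // => /eqP.
Qed.

Lemma subtree_child w u : u \in Bv -> u != v -> parent u \in subtree w ->
  u \in subtree w.
Proof.
move=> uB uv; have [_ _ dp] := parentP uB uv.
rewrite !in_subtree uB => /and3P[_ dwp /eqP ip].
by rewrite -dp leqW //= subSn // iterSr ip.
Qed.

(** The edges of the ball used by the breadth-first tree, and the others. *)
Definition tree_edges : {set {set V}} := [set [set u; parent u] | u in Bv :\ v].
Definition nontree_edges := induced_edges e Bv :\: tree_edges.

Lemma pair_set_inj (x y x' y' : V) : [set x; y] = [set x'; y'] ->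
  (x = x' /\ y = y') \/ (x = y' /\ y = x').
Proof.
move=> E.
have /set2P hx : x \in [set x'; y'] by rewrite -E set21.
have /set2P hy : y \in [set x'; y'] by rewrite -E set22.
have /set2P hx' : x' \in [set x; y] by rewrite E set21.
have /set2P hy' : y' \in [set x; y] by rewrite E set22.
by intuition congruence.
Qed.

Lemma card_nontree : (#|nontree_edges|%:Z = tree_excess e Bv)%R.
Proof.
have sub : tree_edges \subset induced_edges e Bv.
  apply/subsetP => E /imsetP[u /setD1P[uv uB] ->].
  have [eu pB _] := parentP uB uv.
  by apply/imset2P; exists u (parent u) => //; rewrite inE pB.
have inj : {in Bv :\ v &, injective (fun u => [set u; parent u])}.
  move=> u u'; rewrite !in_setD1 => /andP[uv uB] /andP[uv' uB'] /pair_set_inj[[]//|[E1 E2]].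
  have [_ _ d1] := parentP uB uv; have [_ _ d2] := parentP uB' uv'.
  have : (d u' < d u)%N by rewrite -d1 E2.
  by rewrite E1 -d2 ltnNge leqW.
have cT : #|tree_edges|.+1 = #|Bv|.
  by rewrite card_in_imset // [RHS](cardsD1 v) ball_root.
rewrite /tree_excess -cT cardsD (setIidPr sub) -subzn ?subset_leq_card //.
rewrite -addn1 PoszD; ring.
Qed.

(** The only tree edge leaving the subtree of [c] joins [c] to its parent, so
    that a subtree is joined to the rest of the ball by few edges. *)
Lemma card_cross_subtree c (X A : {set V}) : X \subset Bv ->
  (#|cross_edges e (A :&: X :&: subtree c) (A :&: X :\: subtree c)|
   <= (#|nontree_edges|).+1)%N.
Proof.
move=> /subsetP XB; set B := A :&: X :&: _; set D := A :&: X :\: _.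
have inj : {in cross_edges e B D &, injective (fun p : V * V => [set p.1; p.2])}.
  move=> [u x] [u' x']; rewrite [in X in X -> _]in_set [in X in _ -> X -> _]in_set /=.
  move=> /and3P[/setIP[_ uT] xD _] /and3P[uB' /setDP[_ xT'] _].
  by case/pair_set_inj => [[-> ->]//|[E1 E2]]; rewrite -E1 uT in xT'.
rewrite -(card_in_imset inj).
apply: (@leq_trans #|[set c; parent c] |: nontree_edges|); last first.
  by rewrite cardsU1; case: (_ \notin _).
apply/subset_leq_card/subsetP => E' /imsetP[[u x]]; rewrite in_set /= => /and3P[].
move=> /setIP[/setIP[uA uX] uT] /setDP[/setIP[xA xX] xT] eux ->.
have uB := XB _ uX; have xB := XB _ xX.
have ind : [set u; x] \in induced_edges e Bv.
  by apply/imset2P; exists u x; rewrite // inE xB eux.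
rewrite inE in_setD ind andbT; case tE: (_ \in tree_edges); last by rewrite orbT.
rewrite orbF in_set1; move: tE => /imsetP[y /setD1P[yv yB]] E.
case: (pair_set_inj E) => [[uy xp]|[up xy]].
  rewrite uy xp; have [-> //|yc] := eqVneq y c.
  by case/negP: xT; rewrite xp subtree_parent // -uy.
by case/negP: xT; rewrite xy subtree_child // -up.
Qed.

End Tree.

(** * The Poincare inequality inside a ball *)

Section TreePoincare.
Variables (R : realType) (V S : finType) (e : rel V) (h : S -> R) (g : S -> S -> R).
Hypothesis esym : symmetric e.
Variable beta : R.
Hypothesis beta_ge0 : 0 <= beta.
Hypothesis g_le : forall x y, `|g x y| <= beta.
Local Notation w := (@boltz R V S e h g).
Variables (v : V) (l : R).
Hypothesis l_ge0 : 0 <= l.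
Local Notation d u := (gdist e u v).
Local Notation Bv := (ball_vertices e v l).
Local Notation T := (subtree e v l).
Local Notation par := (parent e v).
Variables (t : nat) (t_le : (#|nontree_edges e v l| <= t)%N).
Variables (f : {ffun V -> S} -> R) (A : {set V}).

(** The price of cutting one subtree off a set of vertices. *)
Definition peel_factor : R := expR (2 * beta * t.+1%:R).
Local Notation lam := peel_factor.
Local Notation bv X := (bvar w X f).

Lemma peel_factor_ge1 : 1 <= lam.
Proof.
rewrite /peel_factor -expR0 ler_expR.
by rewrite mulr_ge0 // mulr_ge0.
Qed.

Lemma bvar_peel c (X : {set V}) : X \subset Bv ->
  bv (A :&: X) <= lam * (bv (A :&: (X :\: T c)) + bv (A :&: T c)).
Proof.
move=> XB.
have -> : bv (A :&: X) = bv ((A :&: X :&: T c) :|: (A :&: X :\: T c)).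
  by rewrite setID.
apply: le_trans (bvar_split h esym beta_ge0 g_le f _) _.
  by apply/pred0P => u /=; rewrite in_setI in_setD; case: (u \in T c); rewrite ?andbF.
apply: ler_pM.
- exact: expR_ge0.
- by rewrite addr_ge0 // bvar_ge0 // => s; exact: boltz_gt0.
- rewrite ler_expR ler_wpM2l ?mulr_ge0 // ler_nat.
  by apply: leq_trans (card_cross_subtree l_ge0 c A XB) _; rewrite ltnS.
rewrite addrC; apply: lerD; apply: bvar_mono => //; try exact: boltz_gt0.
  by rewrite setIDA.
by apply/setSI/subsetIl.
Qed.

(** The subtrees of the list [cs] are cut off one after another. *)
Lemma bvar_peels (cs : seq V) (X : {set V}) : X \subset Bv ->
  bv (A :&: X) <= lam ^+ size cs *
    (bv (A :&: (X :\: \bigcup_(c <- cs) T c)) + \sum_(c <- cs) bv (A :&: T c)).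
Proof.
elim: cs X => [|c cs IH] X XB.
  by rewrite !big_nil setD0 addr0 expr0 mul1r.
rewrite !big_cons [size _]/= exprS -mulrA.
apply: le_trans (bvar_peel c XB) _; rewrite ler_wpM2l ?expR_ge0 //.
have ge1 : 1 <= lam ^+ size cs by rewrite exprn_ege1 // peel_factor_ge1.
have bv0 Y : 0 <= bv Y by apply: bvar_ge0 => s; exact: boltz_gt0.
rewrite addrCA mulrDr [leLHS]addrC; apply: lerD; first by rewrite ler_peMl.
apply: le_trans (IH _ (subset_trans (subsetDl _ _) XB)) _.
by rewrite setDDl.
Qed.

Definition children x := [set c in Bv | (c != v) && (par c == x)].

Definition deg x := #|[pred y | e x y]|.

Lemma card_children x : (#|children x| <= deg x)%N.
Proof.
apply/subset_leq_card/subsetP => c; rewrite in_set => /and3P[cB cv /eqP <-].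
by have [ec _ _] := parentP cB cv; rewrite inE esym.
Qed.

(** The sum of the degrees of the proper ancestors of [x]. *)
Definition anc_deg x := (\sum_(i < d x) deg (iter i.+1 par x))%N.

Lemma anc_deg_child x c : c \in children x -> anc_deg c = (deg x + anc_deg x)%N.
Proof.
rewrite in_set => /and3P[cB cv /eqP px]; have [_ _ dc] := parentP cB cv.
rewrite /anc_deg -dc px big_ord_recl; congr (_ + _)%N; first by rewrite /= px.
by apply: eq_bigr => i _; rewrite lift0 (iterSr _ _ c) px.
Qed.

Lemma subtree_child_of x u : x \in Bv -> u \in T x -> u != x ->
  let c := iter (d u - (d x).+1) par u in c \in children x /\ u \in T c.
Proof.
move=> xB; rewrite in_subtree => /and3P[uB dxu /eqP iu] ux c.
have lt : (d x < d u)%N.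
  rewrite ltn_neqAle dxu andbT; apply: contraNneq ux => dE.
  by move: iu; rewrite dE subnn /= => ->.
have [dc cB] := gdist_iter_parent l_ge0 (d u - (d x).+1) uB.
rewrite subKn // in dc.
split; last by rewrite in_subtree uB dc lt /= eqxx.
rewrite in_set cB /= -iterS -subSn // subSS iu eqxx andbT.
by apply: contraTneq lt => cv; rewrite -leqNgt; move: dc; rewrite -/c cv gdist0.
Qed.

(** The subtrees of the children of [x] are disjoint. *)
Lemma sum_children_le (F : V -> R) x : x \in Bv -> (forall u, 0 <= F u) ->
  \sum_(c in children x) \sum_(u in T c) F u <= \sum_(u in T x | u != x) F u.
Proof.
move=> xB F0; rewrite (exchange_big_dep xpredT) //= [leRHS]big_mkcond /=.
apply: ler_sum => u _.
have key c : c \in children x -> u \in T c ->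
    [/\ c = iter (d u - (d x).+1) par u, u \in T x & u != x].
  rewrite in_set in_subtree => /and3P[cB cv /eqP pc] /and3P[uB dcu /eqP ic].
  have [_ _ dc] := parentP cB cv; rewrite pc in dc.
  rewrite dc ic; split=> //; last first.
    by apply: contraTneq dcu => ->; rewrite -dc ltnn.
  rewrite in_subtree uB (leq_trans _ dcu) -?dc //=.
  rewrite -dc in dcu ic; rewrite -[(d u - d x)%N]subSS subSn // iterS.
  by rewrite ic pc.
case: ifP => [_|no].
  rewrite (eq_bigl (fun c => (c == iter (d u - (d x).+1) par u) &&
    ((c \in children x) && (u \in T c)))).
    rewrite big_mkcondr big_pred1_eq; case: ifP => // _; exact: F0.
  move=> c /=; case: andP => [[h1 h2]|]; rewrite ?andbF // andbT.
  by have [-> _ _] := key _ h1 h2; rewrite eqxx.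
rewrite big1 // => c /andP[h1 h2]; have [_ h3 h4] := key _ h1 h2.
by rewrite h3 h4 in no.
Qed.

Variable M : nat.
Hypothesis path_deg : forall x, x \in Bv -> (anc_deg x + deg x <= M)%N.

(** By induction from the leaves: cutting off the subtrees of the children of
    [x] costs a factor [peel_factor] for each of them, hence at most
    [peel_factor ^+ deg x]; the total price along a path from the root is
    governed by the sum of its degrees. *)
Lemma bvar_subtree x : x \in Bv ->
  bv (A :&: T x) <= lam ^+ (M - anc_deg x) * \sum_(u in T x) bv [set u].
Proof.
have bv0 Y : 0 <= bv Y by apply: bvar_ge0 => s; exact: boltz_gt0.
have l1 := peel_factor_ge1.
have l0 : 0 <= lam by exact: expR_ge0.
have [k] := ubnP ((Num.truncn l).+1 - d x); elim: k x => // k IH x; rewrite ltnS => dk xB.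
have xT : x \in T x by rewrite in_subtree xB leqnn subnn eqxx.
pose cs := enum (children x).
apply: le_trans (bvar_peels cs (subtree_ball e v l x)) _.
have szle : (size cs <= deg x)%N by rewrite -cardE card_children.
have -> : (M - anc_deg x = size cs + (M - anc_deg x - size cs))%N.
  by rewrite subnKC // leq_subRL ?(leq_trans _ (path_deg xB)) ?leq_add2l ?leq_addr.
rewrite exprD -mulrA ler_wpM2l ?exprn_ge0 //.
rewrite (bigD1 x) //= mulrDr; apply: lerD.
  apply: (@le_trans _ _ (bv [set x])); last first.
    by rewrite ler_peMl // exprn_ege1.
  apply: bvar_mono; first by move=> s; exact: boltz_gt0.
  apply/subsetP => u /setIP[_ /setDP[uT]]; rewrite in_set1; apply: contraNT => ux.
  have [cC uC] := subtree_child_of xB uT ux.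
  rewrite (big_rem (iter (d u - (d x).+1) par u)) ?mem_enum //=.
  by rewrite in_setU uC.
rewrite big_enum /=.
apply: le_trans (ler_wpM2l _ (sum_children_le xB (fun u => bv0 [set u]))); last first.
  by rewrite exprn_ge0.
rewrite mulr_sumr; apply: ler_sum => c cC.
have := cC; rewrite in_set => /and3P[cB cv /eqP pc].
have [_ _ dc] := parentP cB cv; rewrite pc in dc.
have dV : (d x < (Num.truncn l).+1)%N.
  by rewrite ltnS truncn_ge_nat //; move: xB; rewrite in_set => /andP[].
apply: le_trans (IH c _ cB) _.
  by rewrite -dc; apply: leq_trans dk; rewrite ltn_sub2l.
rewrite ler_wpM2r ?sumr_ge0 // ler_weXn2l //.
by rewrite (anc_deg_child cC) addnC subnDA leq_sub2l.
Qed.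

Lemma bvar_ball : bv (A :&: Bv) <= lam ^+ M * \sum_u bv [set u].
Proof.
have bv0 Y : 0 <= bv Y by apply: bvar_ge0 => s; exact: boltz_gt0.
rewrite -{1}(subtree_root e v l_ge0).
apply: le_trans (bvar_subtree (ball_root e v l_ge0)) _.
rewrite /anc_deg gdist0 big_ord0 subn0 ler_wpM2l ?exprn_ge0 ?expR_ge0 //.
rewrite [leRHS](bigID (mem (T v))) /= lerDl.
by apply: sumr_ge0 => u _.
Qed.

End TreePoincare.

(** * Decay of correlations *)

Section Decay.
Variables (R : realType) (V S : finType) (e : rel V) (h : S -> R) (g : S -> S -> R).
Hypotheses (esym : symmetric e) (eirr : irreflexive e).
Hypothesis gsym : forall x y, g x y = g y x.
Variable beta : R.
Hypothesis g_le : forall x y, `|g x y| <= beta.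
Local Notation Om := {ffun V -> S}.
Local Notation w := (@boltz R V S e h g).
Implicit Types (a b s : Om) (J : {set V * V}).

(** Edges are oriented by the enumeration of [V], so that every edge is a single
    ordered pair. *)
Definition oedge (p : V * V) := e p.1 p.2 && (enum_rank p.1 < enum_rank p.2)%N.

Definition orient (x y : V) : V * V :=
  if (enum_rank x < enum_rank y)%N then (x, y) else (y, x).

Lemma orient_sym x y : x != y -> orient x y = orient y x.
Proof.
move=> xy; rewrite /orient; case: ltngtP => // E.
by case/eqP: xy; apply/enum_rank_inj/val_inj.
Qed.

Lemma half_sum_oedge (G : V -> V -> R) : (forall x y, G x y = G y x) ->
  2^-1 * \sum_x \sum_(y | e x y) G x y = \sum_(p | oedge p) G p.1 p.2.
Proof.
move=> Gs; rewrite pair_big_dep /=.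
rewrite (bigID (fun p : V * V => (enum_rank p.1 < enum_rank p.2)%N)) /=.
rewrite [X in _ + X](reindex_inj (can_inj (@swap_pairK V V))) /=.
rewrite [X in _ + X](_ : _ = \sum_(p | oedge p) G p.1 p.2).
  by rewrite /oedge; set X := \sum_(p | _) _; lra.
apply: eq_big => [[x y]|p _] /=; last by rewrite Gs.
rewrite /oedge /= esym; case exy: (e x y) => //=.
rewrite -leqNgt leq_eqVlt; case: eqP => // E.
by move: exy; rewrite (enum_rank_inj (val_inj E)) eirr.
Qed.

(** With this normalisation the edge [p] contributes [1 + edge_excess a b p] to
    the weight of the pair [(a, b)], and the excess is small and nonnegative.  It
    is set to 0 at the pairs that are not oriented edges, so that products may
    run over all pairs. *)
Definition edge_excess a b (p : V * V) : R :=
  if oedge p then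
    expR (g (a p.1) (a p.2) + g (b p.1) (b p.2) + 2 * beta) - 1
  else 0.

(** An upper bound for the excess: the percolation parameter. *)
Definition edge_prob : R := expR (4 * beta) - 1.

Lemma edge_excess_bound a b p : 0 <= edge_excess a b p <= edge_prob.
Proof.
have b0 : 0 <= beta by apply: le_trans (g_le (a p.1) (a p.1)).
rewrite /edge_excess /edge_prob; case: ifP => _; last first.
  by rewrite lexx subr_ge0 -expR0 ler_expR mulr_ge0.
have := g_le (a p.1) (a p.2); have := g_le (b p.1) (b p.2).
rewrite !ler_norml => /andP[h1 h2] /andP[h3 h4].
by rewrite subr_ge0 -{1}expR0 lerB // ?ler_expR; lra.
Qed.

Definition site_weight a b : R :=
  expR (\sum_x (h (a x) + h (b x)) - \sum_(p | oedge p) 2 * beta).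

Lemma pair_boltz a b :
  w a * w b = site_weight a b * \prod_p (edge_excess a b p + 1).
Proof.
have -> : \prod_p (edge_excess a b p + 1) = expR (\sum_(p | oedge p)
    (g (a p.1) (a p.2) + g (b p.1) (b p.2) + 2 * beta)).
  rewrite expR_sum [RHS]big_mkcond /=; apply: eq_bigr => p _.
  by rewrite /edge_excess; case: ifP => _; rewrite ?subrK ?add0r.
rewrite /boltz -!expRD; congr expR.
rewrite /hamiltonian !half_sum_oedge; try by move=> x y.
by rewrite !big_split /=; ring.
Qed.

(** The contribution of the set [J] of open edges in the expansion of the product
    of the factors [1 + edge_excess a b p]. *)
Definition subset_weight a b J : R :=
  \prod_p (if p \in J then edge_excess a b p else 1).

Lemma subset_weight_ge0 a b J : 0 <= subset_weight a b J.
Proof.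
apply: prodr_ge0 => p _; case: ifP => // _.
by case/andP: (edge_excess_bound a b p).
Qed.

Lemma pair_boltz_sum a b :
  w a * w b = \sum_(J : {set V * V}) site_weight a b * subset_weight a b J.
Proof. by rewrite pair_boltz bigA_distr mulr_sumr. Qed.

(** The edges of a given list are all open with weight at most
    [edge_prob ^+ size Eg], as in independent percolation. *)
Lemma sum_subset_weight a b (Eg : seq (V * V)) : uniq Eg ->
  \sum_(J : {set V * V} | all (mem J) Eg) subset_weight a b J <=
  edge_prob ^+ size Eg * \prod_p (edge_excess a b p + 1).
Proof.
move=> uE.
have -> : \sum_(J : {set V * V} | all (mem J) Eg) subset_weight a b J =
    \prod_p (edge_excess a b p + (p \notin Eg)%:R).
  rewrite bigA_distr big_mkcond; apply: eq_bigr => J _; case: allP => [sEJ|nE].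
    apply: eq_bigr => p _; case: ifP => // /negbT pJ.
    by rewrite (contra (sEJ p) pJ).
  have [p pE pJ] : exists2 p, p \in Eg & p \notin J.
    by apply/hasP; rewrite has_predC; apply/negP => /allP.
  by rewrite (bigD1 p) //= (negbTE pJ) pE mul0r.
have -> : edge_prob ^+ size Eg = \prod_p (if p \in Eg then edge_prob else 1).
  by rewrite -big_mkcond prodr_const; rewrite (card_uniqP uE).
rewrite -big_split /=; apply: ler_prod => p _.
have /andP[h1 h2] := edge_excess_bound a b p.
case: (p \in Eg); rewrite ?addr0 ?mul1r ?addr_ge0 ?lexx //= h1 /=; nra.
Qed.

(** Adjacency through the open edges, and the open cluster of a vertex. *)
Definition open J : rel V := fun x y => e x y && (orient x y \in J).
Definition cluster J x := [set y | connect (open J) x y].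

Lemma open_sym J : symmetric (open J).
Proof.
move=> x y; rewrite /open esym; case exy: (e y x) => //=.
by rewrite orient_sym //; apply: contraTneq exy => ->; rewrite eirr.
Qed.

(** Exchanging the two configurations on an open cluster preserves the weight,
    because no open edge leaves the cluster. *)
Lemma subset_weight_swap a b J x :
  let C := cluster J x in
  site_weight (mix C a b) (mix C b a) * subset_weight (mix C a b) (mix C b a) J =
  site_weight a b * subset_weight a b J.
Proof.
move=> C; congr (_ * _).
  rewrite /site_weight; suff -> : \sum_y (h (mix C a b y) + h (mix C b a y)) =
    \sum_y (h (a y) + h (b y)) by [].
  apply: eq_bigr => y _.
  by rewrite !ffunE; case: ifP => // _; rewrite addrC.
apply: eq_bigr => p _; case: ifP => // pJ; rewrite /edge_excess; case: ifP => // /andP[ep rp].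
have -> : (mix C a b) = [ffun u => if u \in C then b u else a u] by [].
have E : (p.1 \in C) = (p.2 \in C).
  rewrite !in_set; apply: same_connect_r; first exact/sym_connect_sym/open_sym.
  apply: connect1; rewrite /open ep /orient rp; by case: (p) pJ.
by rewrite !ffunE -E; case: ifP => // _; rewrite [g (b _) _ + _]addrC.
Qed.

Lemma pairmap_orient_mem x q p : p \in pairmap orient x q ->
  (p.1 \in x :: q) && (p.2 \in x :: q).
Proof.
elim: q x => //= y q IH x; rewrite inE => /orP[/eqP->|/IH/andP[h1 h2]].
  by rewrite /orient; case: ifP; rewrite /= !inE !eqxx ?orbT.
by rewrite ![_ \in x :: _]inE h1 h2 !orbT.
Qed.

Lemma pairmap_orient_uniq x q : uniq (x :: q) -> uniq (pairmap orient x q).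
Proof.
elim: q x => //= y q IH x /andP[xq uq]; rewrite IH // andbT.
apply: contra xq => /pairmap_orient_mem.
by rewrite /orient; case: ifP => _ /andP[].
Qed.

Lemma path_open J x q : path (open J) x q ->
  path e x q && all (mem J) (pairmap orient x q).
Proof.
elim: q x => //= y q IH x /andP[/andP[-> ->] /IH/andP[-> ->]]; by [].
Qed.

(* N is a neighbourhood of v of radius at least L - 1, and saws contains all
   self-avoiding paths of length L from v, without their starting point. *)
Variables (v : V) (N : {set V}) (L : nat) (saws : seq (seq V)).
Hypothesis sawsP : forall q, path e v q -> uniq (v :: q) -> size q = L ->
  q \in saws.
Hypothesis saws_uniq : forall q, q \in saws -> uniq (v :: q) /\ size q = L.
Hypothesis far : forall q, path e v q -> last v q \notin N -> (L <= size q)%N.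

(** If the open cluster of [v] leaves [N], then some self-avoiding path of length
    [L] from [v] is open. *)
Lemma bad_saw J : ~~ (cluster J v \subset N) ->
  exists2 q, q \in saws & all (mem J) (pairmap orient v q).
Proof.
case/subsetPn => y; rewrite in_set => /connectP[q0 pq0 ->].
case: (shortenP pq0) => q pq uq _ yN.
have /andP[eq Jq] := path_open pq.
have sz := far eq yN.
exists (take L q).
  apply: sawsP; first by rewrite take_path.
    by have := take_uniq L.+1 uq.
  by rewrite size_takel.
by have /andP[] := path_open (take_path L pq).
Qed.

(** A union bound for the weight of the sets of open edges whose cluster at [v]
    leaves [N]. *)
Definition decay_bound : R := (size saws)%:R * edge_prob ^+ L.

Lemma sum_bad a b :
  \sum_(J : {set V * V} | ~~ (cluster J v \subset N)) subset_weight a b J <=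
  decay_bound * \prod_p (edge_excess a b p + 1).
Proof.
apply: (@le_trans _ _ (\sum_(q <- saws) \sum_(J : {set V * V} | all (mem J) (pairmap orient v q))
   subset_weight a b J)).
  under [leRHS]eq_bigr => q _ do rewrite big_mkcond.
  rewrite exchange_big big_mkcond; apply: ler_sum => J _ /=.
  have t0 q : 0 <= (if all (mem J) (pairmap orient v q) then subset_weight a b J else 0).
    by case: ifP => // _; exact: subset_weight_ge0.
  case: ifP => [/bad_saw[q qs aq]|_]; last by apply: sumr_ge0.
  by rewrite (big_rem q) //= aq lerDl; apply: sumr_ge0.
rewrite /decay_bound -mulrA mulr_natl -[X in _ *+ X]count_predT -iter_addr_0 -big_const_seq.
rewrite big_seq [leRHS]big_seq; apply: ler_sum => q qs.
have [uq <-] := saws_uniq qs.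
rewrite -(size_pairmap orient v q); apply/sum_subset_weight/pairmap_orient_uniq => //.
Qed.

(** The law of the spin at [v] under resampling of [B] hardly depends on the
    configuration off [N].  Two independent copies, one for each boundary
    condition, are expanded over the sets [J] of open edges: if the cluster of
    [v] stays in [N], where the boundary conditions agree, then exchanging the
    copies on the cluster shows that [J] contributes 0 to the difference. *)
Lemma site_decay (B : {set V}) s s' (phi : S -> R) (M : R) :
  (forall u, u \notin B -> u \in N -> s u = s' u) ->
  (forall x, `|phi x| <= M) ->
  ce w B (fun t => phi (t v)) s - ce w B (fun t => phi (t v)) s' <=
  2 * M * decay_bound.
Proof.
move=> ss' phiM.
have N0 := blocknorm_gt0 (@boltz_gt0 R V S e h g) B s.
have N0' := blocknorm_gt0 (@boltz_gt0 R V S e h g) B s'.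
pose Ns := blocknorm w B s; pose Ns' := blocknorm w B s'.
rewrite -(ler_pM2r N0) -(ler_pM2r N0') -/Ns -/Ns'.
pose a t := mix B s t; pose b t := mix B s' t.
pose D t t' := phi (a t v) - phi (b t' v).
have -> : (ce w B (fun t => phi (t v)) s - ce w B (fun t => phi (t v)) s') * Ns * Ns' =
   \sum_t \sum_t' w (a t) * w (b t') * D t t'.
  rewrite /ce -/Ns -/Ns' -/(a _) -/(b _).
  have -> (x y : R) : (x / Ns - y / Ns') * Ns * Ns' = x * Ns' - Ns * y.
    by field; rewrite !gt_eqF.
  rewrite /Ns' /Ns /blocknorm mulr_suml mulr_suml -sumrB; apply: eq_bigr => t _.
  rewrite !mulr_sumr -sumrB; apply: eq_bigr => t' _; rewrite /D /a /b; ring.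
have -> : Ns = \sum_t w (a t) by [].
have -> : Ns' = \sum_t w (b t) by [].
pose T J := \sum_t \sum_t' site_weight (a t) (b t') * subset_weight (a t) (b t') J * D t t'.
have -> : \sum_t \sum_t' w (a t) * w (b t') * D t t' = \sum_(J : {set V * V}) T J.
  rewrite [RHS]exchange_big; apply: eq_bigr => t _ /=.
  rewrite [RHS]exchange_big; apply: eq_bigr => t' _ /=.
  by rewrite pair_boltz_sum mulr_suml.
rewrite (bigID (fun J : {set V * V} => cluster J v \subset N)) /= big1 ?add0r; last first.
  move=> J good; pose C := cluster J v.
  have vC : v \in C by rewrite in_set connect0.
  have swa t t' : a (mix C t t') = mix C (a t) (b t').
    apply/ffunP => u; rewrite !ffunE; case uB: (u \in B) => //.
    case uC: (u \in C) => //; apply: ss'; first by rewrite uB.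
    by apply: (subsetP good).
  have swb t t' : b (mix C t' t) = mix C (b t') (a t).
    apply/ffunP => u; rewrite !ffunE; case uB: (u \in B) => //.
    case uC: (u \in C) => //; symmetry; apply: ss'; first by rewrite uB.
    by apply: (subsetP good).
  suff : T J = - T J by lra.
  rewrite {1}/T (sum_mix_swap C) /T -sumrN; apply: eq_bigr => t _.
  rewrite -sumrN; apply: eq_bigr => t' _; rewrite /D swa swb subset_weight_swap.
  by rewrite !ffunE vC; ring.
apply: (@le_trans _ _ (\sum_(J : {set V * V} | ~~ (cluster J v \subset N)) \sum_t \sum_t'
   site_weight (a t) (b t') * subset_weight (a t) (b t') J * (2 * M))).
  apply: ler_sum => J _; apply: ler_sum => t _; apply: ler_sum => t' _.
  apply: ler_wpM2l; first by rewrite mulr_ge0 ?expR_ge0 ?subset_weight_ge0.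
  have := phiM (a t v); have := phiM (b t' v); rewrite !ler_norml /D; lra.
rewrite exchange_big /= -[leRHS]mulrA [(\sum_t w (a t)) * _]mulr_suml [leRHS]mulr_sumr.
apply: ler_sum => t _; rewrite [w _ * _]mulr_sumr [leRHS]mulr_sumr.
rewrite exchange_big /=; apply: ler_sum => t' _.
have M0 : 0 <= 2 * M by rewrite mulr_ge0 // (le_trans _ (phiM (a t v))).
rewrite -mulr_suml -mulr_sumr.
have -> : 2 * M * decay_bound * (w (a t) * w (b t')) = site_weight (a t) (b t') *
    (decay_bound * \prod_p (edge_excess (a t) (b t') p + 1)) * (2 * M).
  rewrite pair_boltz; ring.
by rewrite ler_wpM2r // ler_wpM2l ?expR_ge0 // sum_bad.
Qed.

End Decay.

(** * Counting self-avoiding paths *)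

Section Counting.
Variables (R : realType) (V : finType) (e : rel V).
Hypothesis eirr : irreflexive e.
Local Notation deg := (deg e).

(** The walks of [L] steps from [v], without their starting point. *)
Fixpoint walks L (v : V) : seq (seq V) :=
  if L is L'.+1 then [seq x :: q | x <- enum (e v), q <- walks L' x] else [:: [::]].

Lemma mem_walks L v q : (q \in walks L v) = path e v q && (size q == L).
Proof.
elim: L v q => [|L IH] v q /=.
  by rewrite inE; case: q => //= x q; rewrite andbF.
apply/allpairsPdep/idP => [[x [q' [xv qw ->]]]|].
  by move: xv qw; rewrite mem_enum IH /= eqSS unfold_in => -> /andP[-> ->].
case: q => [|x q] //=.
by rewrite eqSS => /andP[/andP[ex eq] sz]; exists x, q; rewrite mem_enum IH eq sz unfold_in.
Qed.

(** The walk that moves to a uniform neighbour follows [q] with probability the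
    product of the inverse degrees along [q], and [expR (- d) <= d^-1]. *)
Lemma sum_walks L v :
  \sum_(q <- walks L v) expR (- (\sum_(u <- belast v q) deg u)%:R) <= 1 :> R.
Proof.
elim: L v => [|L IH] v /=; first by rewrite big_seq1 /= big_nil oppr0 expR0.
rewrite big_allpairs_dep /=.
apply: (@le_trans _ _ (\sum_(x <- enum (e v)) expR (- (deg v)%:R))).
  apply: ler_sum => x _.
  under eq_bigr => q _ do rewrite big_cons natrD opprD expRD.
  by rewrite -mulr_sumr ler_piMr ?expR_ge0.
rewrite big_enum /= sumr_const expRN -[leLHS]mulr_natl -[#|_|]/(deg v).
rewrite ler_pdivrMr ?expR_gt0 // mul1r.
by apply: le_trans (expR_ge1Dx _); rewrite lerDr.
Qed.

(** The self-avoiding ones. *)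
Definition saws L v := [seq q <- walks L v | uniq (v :: q)].

Lemma size_saws L v (D : R) :
  (forall q, path e v q -> uniq (v :: q) -> size q = L ->
     (\sum_(u <- belast v q) deg u)%:R <= D) ->
  (size (saws L v))%:R <= expR D.
Proof.
move=> hD; rewrite -[expR D]mul1r -ler_pdivrMr ?expR_gt0 // -expRN.
apply: le_trans (sum_walks L v).
apply: (@le_trans _ _ (\sum_(q <- saws L v) expR (- (\sum_(u <- belast v q) deg u)%:R))).
  rewrite mulr_natl -[X in _ *+ X]count_predT -iter_addr_0 -big_const_seq.
  rewrite big_seq [leRHS]big_seq; apply: ler_sum => q.
  rewrite mem_filter mem_walks => /and3P[uq pq /eqP sz].
  by rewrite ler_expR lerN2 hD.
rewrite big_filter [leRHS](bigID (fun q => uniq (v :: q))) /= lerDl.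
by apply: sumr_ge0 => q _; exact: expR_ge0.
Qed.

Variables (alpha l : R).
Hypothesis alpha_gt0 : 0 < alpha.

Lemma dist_weight_deg u : alpha * (deg u)%:R <= \sum_(x | x != u) dist_weight e alpha u x.
Proof.
rewrite /deg -sum1_card natr_sum mulr_sumr /=.
rewrite [leRHS](bigID (fun x => e u x)) /= ler_wpDr //.
  by apply: sumr_ge0 => x _; rewrite /dist_weight; case: ifP => // _; rewrite exprn_ge0 // ltW.
rewrite le_eqVlt; apply/orP; left; apply/eqP; apply: eq_big => [x|x eux].
  rewrite inE; case eux: (e u x); rewrite ?andbF //= andbT.
  by symmetry; apply: contraTneq eux => ->; rewrite eirr.
by rewrite /dist_weight connect1 // gdist_edge // expr1 mulr1.
Qed.

(** The neighbours of the vertices of a path alone give to the path the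
    [alpha]-weight [alpha] times the sum of the degrees. *)
Lemma path_deg_weight (p : seq V) : p != [::] -> sorted e p -> uniq p ->
  (size p).-1%:R <= l -> alpha * (\sum_(u <- p) deg u)%:R <= max_path_weight e alpha l.
Proof.
move=> p0 sp up lp.
have szp : (size p <= #|V|)%N by rewrite -(card_uniqP up) max_card.
pose bp : #|V|.-bseq V := Bseq szp.
apply: (@le_trans _ _ (\sum_(u <- bp) \sum_(x | x != u) dist_weight e alpha u x)).
  by rewrite natr_sum mulr_sumr; apply: ler_sum => u _; exact: dist_weight_deg.
rewrite /max_path_weight.
by apply: (le_bigmax_cond 0 (fun p : #|V|.-bseq V =>
  \sum_(u <- p) \sum_(x | x != u) dist_weight e alpha u x)); rewrite /= p0 sp up lp.
Qed.

Lemma path_traject (f : V -> V) k x :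
  (forall i, (i < k)%N -> e (iter i f x) (f (iter i f x))) ->
  path e x (traject f (f x) k).
Proof.
elim: k x => //= k IH x hx.
by rewrite (hx 0%N) //=; apply: IH => i ik; rewrite -iterSr; apply: (hx i.+1).
Qed.

Lemma anc_deg_weight v x : 0 <= l -> x \in ball_vertices e v l ->
  alpha * (anc_deg e v x + deg x)%:R <= max_path_weight e alpha l.
Proof.
move=> l0 xB; set k := gdist e x v; pose p := traject (parent e v) x k.+1.
have -> : (anc_deg e v x + deg x = \sum_(u <- p) deg u)%N.
  rewrite (big_nth x) size_traject big_mkord big_ord_recl addnC.
  rewrite nth_traject //; congr (_ + _)%N; apply: eq_bigr => i _.
  by rewrite nth_traject ?lift0 // ltnS; exact: ltn_ord.
have dist i : (i <= k)%N ->
    gdist e (iter i (parent e v) x) v = (k - i)%N /\ iter i (parent e v) x \in ball_vertices e v l.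
  by move=> _; exact: gdist_iter_parent.
apply: path_deg_weight => //.
- rewrite /p /=; have : forall i, (i < k)%N ->
      e (iter i (parent e v) x) (parent e v (iter i (parent e v) x)).
    move=> i ik; have [di iB] := dist i (ltnW ik).
    have [] // := parentP iB.
    by apply: contraTneq ik => E; move: di; rewrite E gdist0 -leqNgt -subn_eq0 => <-.
  exact: path_traject.
- apply: (@map_uniq _ _ (fun u => gdist e u v)).
  rewrite (_ : map _ p = [seq (k - i)%N | i <- iota 0 k.+1]).
    rewrite map_inj_in_uniq ?iota_uniq // => i j; rewrite !mem_iota !add0n !ltnS.
    by move=> /= ik jk E; rewrite -(subKn ik) E subKn.
  apply: (@eq_from_nth _ 0%N); rewrite ?size_map ?size_traject ?size_iota // => i ik.
  rewrite (nth_map x) ?size_traject // (nth_map 0%N) ?size_iota // nth_iota // nth_traject //.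
  by have [] := dist i ik.
rewrite size_traject /=; by move: xB; rewrite in_set => /andP[].
Qed.

Lemma saw_count_weight v L : (L%:R <= l) ->
  (size (saws L.+1 v))%:R <= expR (max_path_weight e alpha l / alpha).
Proof.
move=> Ll; apply: size_saws => q pq uq sz.
rewrite ler_pdivlMr // mulrC; apply: path_deg_weight.
- by case: q sz {pq uq}.
- case: q pq {uq sz} => //= x q /andP[ex].
  case/lastP: q => [//|q y]; rewrite belast_rcons rcons_path /= ex.
  by move=> /andP[-> _].
- by move: uq; rewrite lastI rcons_uniq => /andP[].
by rewrite size_belast sz.
Qed.

End Counting.

(** * The Poincare inequality from a scan of the blocks *)

Lemma jensen_sq (R : realType) (I : finType) (w d : I -> R) : (forall i, 0 <= w i) ->
  (\sum_i w i * d i) ^+ 2 <= (\sum_i w i) * (\sum_i w i * d i ^+ 2).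
Proof.
move=> w0.
have : 0 <= \sum_i \sum_j w i * w j * (d i - d j) ^+ 2.
  by apply: sumr_ge0 => i _; apply: sumr_ge0 => j _; rewrite mulr_ge0 ?sqr_ge0 // mulr_ge0.
have -> : \sum_i \sum_j w i * w j * (d i - d j) ^+ 2 =
   \sum_i \sum_j (w i * d i ^+ 2) * w j + \sum_i \sum_j w i * (w j * d j ^+ 2)
   - 2 * \sum_i \sum_j (w i * d i) * (w j * d j).
  rewrite mulr_sumr -sumrN -!big_split /=; apply: eq_bigr => i _.
  by rewrite mulr_sumr -sumrN -!big_split /=; apply: eq_bigr => j _; ring.
under eq_bigr => i _ do rewrite -mulr_sumr.
under [X in _ + X - _]eq_bigr => i _ do rewrite -mulr_sumr.
under [X in _ + _ - _ * X]eq_bigr => i _ do rewrite -mulr_sumr.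
rewrite -!mulr_suml. nra.
Qed.

Section Scan.
Variables (R : realType) (V S : finType).
Local Notation Om := {ffun V -> S}.
Variable w : Om -> R.
Hypothesis w_gt0 : forall s, 0 < w s.
Implicit Types (f : Om -> R) (s : Om) (Bs : seq {set V}) (U : {set V}).

(** The block dynamics that resamples the blocks of [Bs] in turn, starting with
    the first one, as an operator on functions. *)
Definition scan Bs f : Om -> R := foldr (ce w) f Bs.

Lemma scan_sqdist Bs f :
  \sum_s w s * (f s - scan Bs f s) ^+ 2 <= \sum_(B <- Bs) bvar w B f.
Proof.
elim: Bs => [|B Bs IH] /=.
  by rewrite big_nil big1 // => s _; rewrite subrr expr0n mulr0.
rewrite big_cons; apply: le_trans (sqnorm_ce_step w_gt0 B f _) _.
by rewrite lerD2l.
Qed.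

Lemma scan_kernel Bs f s :
  scan Bs f s = \sum_y f y * scan Bs (fun t => (t == y)%:R) s.
Proof.
elim: Bs s => [|B Bs IH] s /=.
  rewrite (bigD1 s) //= eqxx mulr1 big1 ?addr0 // => y ys.
  by rewrite eq_sym (negbTE ys) mulr0.
by rewrite (eq_ce w B IH) ce_sum.
Qed.

Lemma scan_ge Bs f c s : (forall t, c <= f t) -> c <= scan Bs f s.
Proof. by move=> cf; elim: Bs s => //= B Bs IH s; apply: ce_ge. Qed.

Lemma scan_le Bs f c s : (forall t, f t <= c) -> scan Bs f s <= c.
Proof. by move=> cf; elim: Bs s => //= B Bs IH s; apply: ce_le. Qed.

Lemma scan_mean Bs f : \sum_s w s * scan Bs f s = \sum_s w s * f s.
Proof. by elim: Bs => //= B Bs IH; rewrite ce_mean. Qed.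

(** [s] and [s'] take the same values on [U]. *)
Definition agree (U : {set V}) s s' := [forall u in U, s u == s' u].

Lemma agreeP (U : {set V}) s s' : reflect (forall u, u \in U -> s u = s' u) (agree U s s').
Proof. by apply: (iffP forall_inP) => H u uU; [apply/eqP|rewrite H]; rewrite ?H. Qed.

Variable N : V -> {set V}.

(** The neighbourhoods of the successive vertices, from which the vertices
    already treated are removed. *)
Fixpoint scan_blocks (vs : seq V) (U : {set V}) : seq {set V} :=
  if vs is v :: vs' then (N v :\: U) :: scan_blocks vs' (v |: U) else [::].

Variable eta : R.
Hypothesis decay : forall v (U : {set V}) s s' (phi : S -> R) (M : R), agree U s s' ->
  (forall x, `|phi x| <= M) ->
  ce w (N v :\: U) (fun t => phi (t v)) s - ce w (N v :\: U) (fun t => phi (t v)) s'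
  <= eta * M.

(** Two copies of the scan, started from configurations that agree on [U], can be
    kept in agreement at all vertices already treated, except with a small
    probability.  In terms of oscillations: after resampling the block of [v], a
    function [F] is up to its oscillation given the values on [v |: U] a function
    of the value at [v] alone, and the law of that value hardly depends on the
    starting configuration. *)
Lemma scan_osc vs U f (M : R) s s' : (forall t, `|f t| <= M) ->
  (forall u, (u \in U) || (u \in vs)) -> agree U s s' ->
  scan (scan_blocks vs U) f s - scan (scan_blocks vs U) f s' <= (size vs)%:R * (eta * M).
Proof.
move=> fM; elim: vs U s s' => [|v vs IH] U s s' cov /agreeP ss'.
  suff -> : s = s' by rewrite subrr mul0r.
  by apply/ffunP => u; apply: ss'; have := cov u; rewrite orbF.
rewrite [scan_blocks _ _]/= [scan _ _]/=.
set B := N v :\: U; set F := scan _ f.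
have cov' u : (u \in v |: U) || (u \in vs).
  by have := cov u; rewrite in_setU1 inE; case: (u \in U); case: (u == v).
have osc t t' : agree (v |: U) t t' -> F t - F t' <= (size vs)%:R * (eta * M).
  exact: IH.
have FM t : `|F t| <= M.
  by rewrite ler_norml scan_ge ?scan_le // => t'; have := fM t'; rewrite ler_norml => /andP[].
(* phi x is the minimum of F over the configurations that agree with s on U
   and take the value x at v; v is excluded from U so that update s v x is
   always a candidate. *)
pose P x t := agree (U :\ v) s t && (t v == x).
pose phi x := F [arg min_(t < update s v x | P x t) F t]%O.
have P0 x : P x (update s v x).
  rewrite /P ffunE !eqxx andbT; apply/agreeP => u /setD1P[uv _].
  by rewrite ffunE (negbTE uv).
have phiP t : agree U s t -> phi (t v) <= F t <= phi (t v) + (size vs)%:R * (eta * M).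
  move=> /agreeP st; rewrite /phi; case: arg_minP; first exact: P0.
  move=> t0 /andP[/agreeP st0 /eqP tv] min.
  rewrite -lerBlDl min /=; last first.
    by rewrite /P eqxx andbT; apply/agreeP => u /setD1P[_ uU]; exact: st.
  apply: osc; apply/agreeP => u /setU1P[->|uU]; first by rewrite tv.
  by have [->|uv] := eqVneq u v; [rewrite tv | rewrite -st // -st0 // !inE uv].
have agB r t : agree U r (mix B r t).
  by apply/agreeP => u uU; rewrite ffunE !inE uU.
have h1 : ce w B F s - ce w B (fun t => phi (t v)) s <= (size vs)%:R * (eta * M).
  rewrite -ceB; apply: ce_le => // t; rewrite lerBlDl.
  by have /andP[_] := phiP _ (agB s t).
have h2 : ce w B (fun t => phi (t v)) s' - ce w B F s' <= 0.
  rewrite -ceB; apply: ce_le => // t; rewrite subr_le0.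
  have /phiP/andP[] // : agree U s (mix B s' t).
  by apply/agreeP => u uU; rewrite ss' //; have /agreeP := agB s' t; apply.
have h3 := decay v (introT (agreeP _ _ _) ss') (fun x => FM _ : `|phi x| <= M).
rewrite /= -/B in h3.
have -> : (size vs).+1%:R * (eta * M) = (size vs)%:R * (eta * M) + eta * M.
  by rewrite -addn1 natrD mulrDl mul1r.
lra.
Qed.

Let Bs := scan_blocks (enum V) set0.
Let Z := \sum_s w s.

(** The kernel of the scan minus the stationary mean: test the oscillation bound
    on the sign of a row. *)
Lemma scan_kernel_l1 s :
  \sum_y `|scan Bs (fun t => (t == y)%:R) s - w y / Z| <= #|V|%:R * eta.
Proof.
have Z0 : 0 < Z.
  by rewrite /Z (bigD1 s) //= ltr_pwDl // sumr_ge0 // => t _; exact: ltW.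
pose q y := scan Bs (fun t => (t == y)%:R) s - w y / Z.
pose sg y : R := Num.sg (q y).
have sg1 y : `|sg y| <= 1 by rewrite normr_sg; case: (_ != 0).
have -> : \sum_y `|scan Bs (fun t => (t == y)%:R) s - w y / Z| =
   scan Bs sg s - (\sum_y w y * scan Bs sg y) / Z.
  rewrite scan_mean (scan_kernel Bs sg s) mulr_suml -sumrB; apply: eq_bigr => y _.
  by rewrite -/(q y) normrEsg -/(sg y) /q; ring.
rewrite lerBlDr -lerBlDl ler_pdivlMr // mulr_sumr.
apply: ler_sum => y _; rewrite mulrC ler_wpM2l ?(ltW (w_gt0 _)) // lerBlDr -lerBlDl.
have := @scan_osc (enum V) set0 sg 1 s y sg1; rewrite mulr1 -cardE; apply.
  by move=> u; rewrite mem_enum orbT.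
by apply/agreeP => u; rewrite in_set0.
Qed.

(** Schur test: the rows of the centred kernel have small l1 norm, and its columns
    have norm at most 2 because [w] is stationary. *)
Lemma scan_contract f : \sum_s w s * f s = 0 -> #|V|%:R * eta <= 8^-1 ->
  \sum_s w s * scan Bs f s ^+ 2 <= 4^-1 * \sum_s w s * f s ^+ 2.
Proof.
move=> f0 small.
pose q s y := scan Bs (fun t => (t == y)%:R) s - w y / Z.
have col y : \sum_s w s * `|q s y| <= 2 * w y.
  apply: (@le_trans _ _ (\sum_s w s * (scan Bs (fun t => (t == y)%:R) s + w y / Z))).
    apply: ler_sum => s _; rewrite ler_wpM2l ?(ltW (w_gt0 _)) //.
    apply: le_trans (ler_normB _ _) _; rewrite !ger0_norm //.
      by rewrite divr_ge0 ?(ltW (w_gt0 _)) // sumr_ge0 // => t _; exact: ltW.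
    by apply: scan_ge => t; exact: ler0n.
  under eq_bigr do rewrite mulrDr; rewrite big_split /= scan_mean -mulr_suml -/Z.
  have Z0 : Z != 0.
    by rewrite gt_eqF // /Z (bigD1 y) //= ltr_pwDl // sumr_ge0 // => t _; exact: ltW.
  rewrite (bigD1 y) //= eqxx big1 ?addr0; last by move=> t /negbTE ->; rewrite mulr0.
  by rewrite mulrCA divff // !mulr1; lra.
have pt s : scan Bs f s ^+ 2 <= 8^-1 * \sum_y `|q s y| * f y ^+ 2.
  have -> : scan Bs f s = \sum_y f y * q s y.
    transitivity (scan Bs f s - (\sum_s w s * f s) / Z); first by rewrite f0 mul0r subr0.
    rewrite scan_kernel mulr_suml -sumrB.
    by apply: eq_bigr => y _; rewrite /q; ring.
  apply: (@le_trans _ _ ((\sum_y `|q s y| * `|f y|) ^+ 2)).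
    rewrite -real_normK ?num_real // lerXn2r ?nnegrE ?sumr_ge0 //.
    by apply: le_trans (ler_norm_sum _ _ _) _; apply: ler_sum => y _; rewrite normrM mulrC.
  apply: le_trans (jensen_sq _ _) _ => //.
  under [in X in _ * X]eq_bigr do rewrite real_normK ?num_real //.
  apply: ler_wpM2r; first by apply: sumr_ge0 => y _; rewrite mulr_ge0 ?sqr_ge0.
  exact: le_trans (scan_kernel_l1 s) small.
apply: (@le_trans _ _ (\sum_s w s * (8^-1 * \sum_y `|q s y| * f y ^+ 2))).
  by apply: ler_sum => s _; rewrite ler_wpM2l // ltW.
have -> : \sum_s w s * (8^-1 * \sum_y `|q s y| * f y ^+ 2) =
   8^-1 * \sum_y f y ^+ 2 * \sum_s w s * `|q s y|.
  under [in RHS]eq_bigr do rewrite mulr_sumr.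
  rewrite [in RHS]exchange_big /= mulr_sumr; apply: eq_bigr => s _.
  rewrite mulrCA mulr_sumr; congr (_ * _); apply: eq_bigr => y _; ring.
have -> : 4^-1 * \sum_s w s * f s ^+ 2 = 8^-1 * \sum_s f s ^+ 2 * (2 * w s).
  rewrite !mulr_sumr; apply: eq_bigr => s _; lra.
by rewrite ler_wpM2l ?invr_ge0 //; apply: ler_sum => y _; rewrite ler_wpM2l ?sqr_ge0.
Qed.

Variable kappa : R.
Hypothesis block_poincare : forall v (U : {set V}) f,
  bvar w (N v :\: U) f <= kappa * \sum_u bvar w [set u] f.

Lemma sum_scan_blocks vs U f :
  \sum_(B <- scan_blocks vs U) bvar w B f <= (size vs)%:R * (kappa * \sum_u bvar w [set u] f).
Proof.
elim: vs U => [|v vs IH] U /=; first by rewrite big_nil mul0r.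
by rewrite big_cons -addn1 natrD mulrDl mul1r addrC lerD.
Qed.

(** A centred [f] is at distance at least half its norm from its image by the
    scan, while this distance is controlled by the block variances. *)
Lemma poincare f : \sum_s w s * f s = 0 -> #|V|%:R * eta <= 8^-1 ->
  \sum_s w s * f s ^+ 2 <= 4 * #|V|%:R * kappa * \sum_u bvar w [set u] f.
Proof.
move=> f0 small; have h1 := scan_contract f0 small.
have h2 := le_trans (scan_sqdist Bs f) (sum_scan_blocks _ _ _).
rewrite -cardE in h2.
have : \sum_s w s * f s ^+ 2 <= 2 * \sum_s w s * (f s - scan Bs f s) ^+ 2 +
    2 * \sum_s w s * scan Bs f s ^+ 2.
  rewrite !mulr_sumr -big_split /=; apply: ler_sum => s _; have := w_gt0 s.
  move: (f s) (scan Bs f s) => x y ws; rewrite -subr_ge0.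
  rewrite [leRHS](_ : _ = w s * (x - 2 * y) ^+ 2); last by ring.
  by rewrite mulr_ge0 ?sqr_ge0 // ltW.
move: h1 h2; set A := \sum_s w s * f s ^+ 2; set D := \sum_s w s * scan _ _ _ ^+ 2.
set E := \sum_s w s * _ ^+ 2; set G := \sum_u _; nra.
Qed.

End Scan.

(** * From the Poincare inequality to the mixing time *)

Section Mixing.
Variables (R : realType) (V S : finType) (e : rel V) (h : S -> R) (g : S -> S -> R).
Hypotheses (esym : symmetric e) (eirr : irreflexive e).
Hypothesis gsym : forall x y, g x y = g y x.
Local Notation Om := {ffun V -> S}.
Local Notation w := (@boltz R V S e h g).
Local Notation P := (gibbs_sampler e h g).
Implicit Types (f : Om -> R) (s y z : Om).

Local Notation w0 := (@boltz_gt0 R V S e h g).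

(** The value at [v] of a uniform configuration is uniform. *)
Lemma sum_coord (v : V) (F : S -> R) :
  (\sum_(t : Om) F (t v)) * #|S|%:R = #|{: Om}|%:R * \sum_x F x.
Proof.
transitivity (\sum_(t : Om) \sum_(x : S) F (t v)).
  by rewrite mulr_suml; apply: eq_bigr => t _; rewrite sumr_const mulr_natr.
rewrite pair_bigA /=.
rewrite (reindex_inj (h := fun p : Om * S => (update p.1 v p.2, p.1 v))) /=.
  rewrite -(pair_bigA _ (fun (t : Om) x => F (update t v x v))) /=.
  under eq_bigr => t _ do under eq_bigr => x _ do rewrite ffunE eqxx.
  by rewrite sumr_const mulr_natl.
apply: (can_inj (g := fun p : Om * S => (update p.1 v p.2, p.1 v))) => -[t x] /=.
rewrite ffunE eqxx; congr pair; apply/ffunP => u; rewrite !ffunE.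
by case: eqP => [->|].
Qed.

Lemma mix_set1 v s (t : Om) : mix [set v] s t = update s v (t v).
Proof. by apply/ffunP => u; rewrite !ffunE in_set1; case: eqP => [->|]. Qed.

Lemma ce_site v f s : ce w [set v] f s =
  (\sum_x heat_bath_weight e h g s v x * f (update s v x)) /
  \sum_x heat_bath_weight e h g s v x.
Proof.
pose K := expR (\sum_(u | u != v) h (s u) +
     2^-1 * \sum_(u | u != v) \sum_(x | e u x && (x != v)) g (s u) (s x)).
have wE x : w (update s v x) = heat_bath_weight e h g s v x * K.
  by rewrite /boltz hamiltonian_split // expRD.
have S0 : #|S|%:R != 0 :> R.
  by rewrite pnatr_eq0 -lt0n; apply/card_gt0P; exists (s v).
have O0 : #|{: Om}|%:R != 0 :> R.
  by rewrite pnatr_eq0 -lt0n; apply/card_gt0P; exists s.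
have K0 : K != 0 by rewrite gt_eqF ?expR_gt0.
have sumE (F : S -> R) : \sum_(t : Om) F (t v) = #|{: Om}|%:R / #|S|%:R * \sum_x F x.
  by apply: (mulIf S0); rewrite sum_coord; field.
rewrite /ce /blocknorm.
under eq_bigr => t _ do rewrite mix_set1.
under [in X in _ / X]eq_bigr => t _ do rewrite mix_set1.
rewrite (sumE (fun x => w (update s v x) * f (update s v x))) (sumE (fun x => w (update s v x))).
under eq_bigr => x _ do rewrite wE mulrAC.
under [in X in _ / X]eq_bigr => x _ do rewrite wE.
rewrite -!mulr_suml; set A := \sum_x _ * f _; set B := \sum_x _.
have B0 : B != 0.
  rewrite gt_eqF // /B (bigD1 (s v)) //= ltr_pwDl ?expR_gt0 //.
  by apply: sumr_ge0 => x _; exact: expR_ge0.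
by field; rewrite B0 K0 S0 O0.
Qed.

Lemma sampler_ce s y :
  P s y = #|V|%:R^-1 * \sum_v ce w [set v] (fun z => (z == y)%:R) s.
Proof.
rewrite /gibbs_sampler mulr_sumr; apply: eq_bigr => v _; congr (_ * _).
rewrite ce_site mulr_suml big_mkcond /=; apply: eq_bigr => x _.
by case: eqP => _; rewrite ?mulr1 ?mulr0 ?mul0r.
Qed.

Lemma ce_sym v f f' : \sum_s w s * (f s * ce w [set v] f' s) =
  \sum_s w s * (f' s * ce w [set v] f s).
Proof.
rewrite -(ce_orth w0 f (ce_off w [set v] f')) -(ce_orth w0 f' (ce_off w [set v] f)).
by apply: eq_bigr => s _; congr (_ * _); rewrite mulrC.
Qed.

Lemma sum_delta s (F : Om -> R) : \sum_z (z == s)%:R * F z = F s.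
Proof.
rewrite (bigD1 s) //= eqxx mul1r big1 ?addr0 // => z /negbTE ->.
by rewrite mul0r.
Qed.

Lemma reversible s y : w s * P s y = w y * P y s.
Proof.
rewrite !sampler_ce mulrCA [RHS]mulrCA; congr (_ * _).
rewrite !mulr_sumr; apply: eq_bigr => v _.
have := ce_sym v (fun z => (z == s)%:R) (fun z => (z == y)%:R).
under eq_bigr => z _ do rewrite mulrCA; rewrite sum_delta => ->.
by under eq_bigr => z _ do rewrite mulrCA; rewrite sum_delta.
Qed.

(** The transition operator of the Gibbs sampler; it is the mean over [v] of the
    projections [ce w [set v]]. *)
Definition sampler_op f s : R := \sum_y P s y * f y.

Lemma sampler_opE f s : sampler_op f s = #|V|%:R^-1 * \sum_v ce w [set v] f s.
Proof.
rewrite /sampler_op; under eq_bigr => y _ do rewrite sampler_ce -mulrA mulr_suml.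
rewrite -mulr_sumr exchange_big /=; congr (_ * _); apply: eq_bigr => v _.
under eq_bigr => y _ do rewrite mulrC.
rewrite -ce_sum; apply: eq_ce => t.
rewrite -[RHS](sum_delta t f); apply: eq_bigr => y _.
by rewrite mulrC eq_sym.
Qed.

(** The density, with respect to [w], of the law after [k] steps; by reversibility
    it evolves under the transition operator itself. *)
Definition density s k : Om -> R := iter k sampler_op (fun z => (z == s)%:R / w s).

Lemma chain_law_density s k y : chain_law P s k y = w y * density s k y.
Proof.
elim: k y => [|k IH] y /=.
  case: eqP => [->|]; last by rewrite mul0r mulr0.
  by rewrite mul1r divff // gt_eqF ?w0.
rewrite /sampler_op mulr_sumr; apply: eq_bigr => z _.
by rewrite -/(chain_law P s k z) IH mulrAC reversible mulrA.
Qed.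

Hypothesis V0 : (0 < #|V|)%N.
Let n : R := #|V|%:R.

Let n_gt0 : 0 < n. Proof. by rewrite ltr0n. Qed.

Let avg_const (x : R) : n^-1 * (\sum_(v : V) x) = x.
Proof. by rewrite sumr_const -mulr_natr mulrCA mulVf ?mulr1 // gt_eqF. Qed.

Lemma sampler_op_mean f : \sum_s w s * sampler_op f s = \sum_s w s * f s.
Proof.
under eq_bigr => s _ do rewrite sampler_opE mulrCA mulr_sumr.
rewrite -mulr_sumr exchange_big /=.
under eq_bigr => v _ do rewrite (ce_mean w0).
exact: avg_const.
Qed.

Lemma sampler_opB f (c : R) s : sampler_op (fun y => f y - c) s = sampler_op f s - c.
Proof.
rewrite !sampler_opE.
under eq_bigr => v _ do rewrite ceB (@ce_id _ _ _ _ w0 [set v] (fun=> c)) //.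
rewrite sumrB mulrBr; congr (_ - _).
exact: avg_const.
Qed.

(** The square of a mean of orthogonal projections is at most the mean of the
    squares. *)
Lemma sampler_op_sqnorm f : \sum_s w s * sampler_op f s ^+ 2 <=
  \sum_s w s * f s ^+ 2 - n^-1 * \sum_v bvar w [set v] f.
Proof.
have pt s : sampler_op f s ^+ 2 <= n^-1 * \sum_v ce w [set v] f s ^+ 2.
  have one : \sum_(v : V) n^-1 = 1 by rewrite sumr_const -mulr_natr mulVf // gt_eqF.
  have := @jensen_sq R V (fun=> n^-1) (fun v => ce w [set v] f s).
  rewrite -!mulr_sumr -sampler_opE one mul1r; apply=> v.
  by rewrite invr_ge0 ltW.
apply: (@le_trans _ _ (\sum_s w s * (n^-1 * \sum_v ce w [set v] f s ^+ 2))).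
  by apply: ler_sum => s _; rewrite ler_wpM2l // ltW ?w0.
under eq_bigr => s _ do rewrite mulrCA mulr_sumr.
rewrite -mulr_sumr exchange_big /=.
have cev v : \sum_s w s * ce w [set v] f s ^+ 2 = \sum_s w s * f s ^+ 2 - bvar w [set v] f.
  have := @pythagoras R V S w w0 [set v] f (fun=> 0) (fun _ _ => erefl).
  under eq_bigr do rewrite subr0; under [X in _ + X]eq_bigr do rewrite subr0.
  by move=> ->; rewrite addrC addKr.
under eq_bigr => v _ do rewrite cev.
by rewrite sumrB mulrBr avg_const.
Qed.

Variable c : R.
Hypothesis c_ge1 : 1 <= c.
Hypothesis poinc : forall f, \sum_s w s * f s = 0 ->
  \sum_s w s * f s ^+ 2 <= c * \sum_u bvar w [set u] f.

Let Z := \sum_s w s.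
Let gam := (n * c)^-1.

Lemma density_mean s k : \sum_y w y * density s k y = 1.
Proof.
elim: k => [|k IH] /=; last by rewrite sampler_op_mean.
under eq_bigr => y _ do rewrite mulrC -mulrA.
by rewrite sum_delta mulVf // gt_eqF ?w0.
Qed.

(** The squared distance to equilibrium decays by the factor [1 - gam] at each
    step. *)
Lemma density_decay s k :
  \sum_y w y * (density s k y - Z^-1) ^+ 2 <= expR (- (gam * k%:R)) / w s.
Proof.
have c0 : 0 < c by apply: lt_le_trans c_ge1.
have Z0 : 0 < Z.
  by rewrite /Z (bigD1 s) //= ltr_pwDl ?w0 // sumr_ge0 // => t _; rewrite ltW ?w0.
elim: k => [|k IH].
  rewrite mulr0 oppr0 expR0 mul1r.
  have -> : \sum_y w y * (density s 0 y - Z^-1) ^+ 2 =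
    \sum_y (y == s)%:R * (w y * ((w s)^-1 ^+ 2)) - 2 * Z^-1 * \sum_y w y * density s 0 y
     + Z^-1 ^+ 2 * \sum_y w y.
    rewrite !mulr_sumr -sumrN -!big_split /=; apply: eq_bigr => y _.
    by case: eqP => [->|_]; rewrite ?mul1r ?mul0r; ring.
  rewrite density_mean sum_delta -/Z.
  have -> : w s * (w s)^-1 ^+ 2 = (w s)^-1.
    by have := w0 s; move: (w s) => x x0; field; rewrite gt_eqF.
  have -> : Z^-1 ^+ 2 * Z = Z^-1 by field; rewrite gt_eqF.
  have : 0 < Z^-1 by rewrite invr_gt0.
  lra.
set q := density s k in IH *; pose f y := q y - Z^-1.
have f0 : \sum_y w y * f y = 0.
  under eq_bigr => y _ do rewrite mulrBr.
  by rewrite sumrB density_mean -mulr_suml -/Z mulfV ?subrr // gt_eqF.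
have -> : \sum_y w y * (density s k.+1 y - Z^-1) ^+ 2 = \sum_y w y * sampler_op f y ^+ 2.
  by apply: eq_bigr => y _; rewrite sampler_opB.
apply: le_trans (sampler_op_sqnorm f) _.
set A := \sum_y w y * f y ^+ 2; set D := \sum_v _.
have h1 : A <= c * D by exact: poinc.
have h2 : A - n^-1 * D <= (1 - gam) * A.
  rewrite mulrBl mul1r lerD2l lerN2 /gam invfM -mulrA ler_wpM2l ?invr_ge0 ?(ltW n_gt0) //.
  by rewrite ler_pdivrMl.
have A0 : 0 <= A by apply: sumr_ge0 => y _; rewrite mulr_ge0 ?sqr_ge0 // ltW ?w0.
apply: le_trans h2 _.
apply: (@le_trans _ _ (expR (- gam) * A)).
  by rewrite ler_wpM2r //; exact: expR_ge1Dx.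
have -> : - (gam * k.+1%:R) = - gam + - (gam * k%:R).
  by rewrite -addn1 natrD; ring.
by rewrite expRD -mulrA ler_wpM2l ?expR_ge0.
Qed.

Variable A : R.
Hypothesis A_ge0 : 0 <= A.
Hypothesis Zw : forall s, Z <= expR A * w s.

Lemma tv_bound s k : A + 2 <= gam * k%:R ->
  total_variation (chain_law P s k) (gibbs_measure e h g) <= (2 * expR 1)^-1.
Proof.
move=> Ak.
have Z0 : 0 < Z.
  by rewrite /Z (bigD1 s) //= ltr_pwDl ?w0 // sumr_ge0 // => t _; rewrite ltW ?w0.
rewrite /total_variation invfM ler_wpM2l ?invr_ge0 //.
have -> : \sum_y `|chain_law P s k y - gibbs_measure e h g y| =
    \sum_y w y * `|density s k y - Z^-1|.
  apply: eq_bigr => y _; rewrite chain_law_density /gibbs_measure -/(boltz e h g y) -/Z.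
  by rewrite -mulrBr normrM ger0_norm // ltW ?w0.
rewrite -(@ler_pXn2r _ 2) ?nnegrE ?invr_ge0 ?expR_ge0 //; last first.
  by apply: sumr_ge0 => y _; rewrite mulr_ge0 // ltW ?w0.
apply: le_trans (jensen_sq _ (fun y => ltW (w0 y))) _.
under [in X in _ * X]eq_bigr => y _ do rewrite real_normK ?num_real //.
apply: le_trans (ler_wpM2l (ltW Z0) (density_decay s k)) _.
rewrite mulrCA; apply: (@le_trans _ _ (expR (- (gam * k%:R)) * expR A)).
  by rewrite ler_wpM2l ?expR_ge0 // ler_pdivrMr ?w0.
rewrite -expRD -expRN -expRM_natl ler_expR; lra.
Qed.

Lemma mixing_time_bound :
  (mixing_time P (gibbs_measure e h g) <= (n * c * (A + 3))%:E)%E.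
Proof.
have c0 : 0 < c by apply: lt_le_trans c_ge1.
pose k := (Num.truncn (n * c * (A + 2))).+1.
have nc : 0 < n * c by rewrite mulr_gt0.
have le_k : A + 2 <= gam * k%:R.
  by rewrite /gam ler_pdivlMl // ltW // truncnS_gt.
apply: (@le_trans _ _ (k%:R)%:E).
  by apply: ereal_inf_lbound; exists k => // s; exact: tv_bound.
rewrite lee_fin /k -addn1 natrD.
have A2 : 0 <= n * c * (A + 2) by rewrite mulr_ge0 ?(ltW nc) ?addr_ge0.
have := truncn_le (n * c * (A + 2)); rewrite A2 => le_t.
have -> : n * c * (A + 3) = n * c * (A + 2) + n * c by ring.
rewrite lerD // -[1%:R]mulr1 ler_pM //.
by rewrite ler1n.
Qed.

End Mixing.

(** * The partition function *)

Section Partition.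
Variables (R : realType) (V S : finType) (e : rel V) (h : S -> R) (g : S -> S -> R).
Variable beta : R.
Hypothesis beta_ge0 : 0 <= beta.
Hypothesis h_le : forall x, `|h x| <= beta.
Hypothesis g_le : forall x y, `|g x y| <= beta.
Local Notation n := (#|V|%:R : R).

Lemma hamiltonian_bound s : `|hamiltonian e h g s| <= beta * (n + n ^+ 2).
Proof.
have sum1 : `|\sum_u h (s u)| <= beta * n.
  apply: le_trans (ler_norm_sum _ _ _) _.
  rewrite mulr_natr -sumr_const; exact: ler_sum.
have sum2 : `|\sum_u \sum_(v | e u v) g (s u) (s v)| <= beta * n ^+ 2.
  apply: le_trans (ler_norm_sum _ _ _) _.
  rewrite expr2 mulrA mulr_natr -sumr_const; apply: ler_sum => u _.
  apply: le_trans (ler_norm_sum _ _ _) _.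
  rewrite big_mkcond mulr_natr -sumr_const; apply: ler_sum => v _ /=.
  by case: ifP.
rewrite /hamiltonian; apply: le_trans (ler_normD _ _) _; rewrite mulrDr; apply: lerD => //.
rewrite normrM ger0_norm ?invr_ge0 //; apply: le_trans sum2.
by rewrite ler_piMl // invf_le1 // ler1n.
Qed.

Lemma partition_bound s : (0 < #|V|)%N ->
  \sum_t boltz e h g t <= expR ((4 * beta + #|S|%:R) * n ^+ 2) * boltz e h g s.
Proof.
move=> V0; have n1 : 1 <= n by rewrite ler1n.
have nn : n <= n ^+ 2 by rewrite expr2 ler_peMl // (le_trans ler01).
set b := beta * (n + n ^+ 2).
apply: (@le_trans _ _ (\sum_(t : {ffun V -> S}) expR b)).
  apply: ler_sum => t _; rewrite ler_expR.
  exact: le_trans (ler_norm _) (hamiltonian_bound t).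
have Hs : - b <= hamiltonian e h g s.
  by have := hamiltonian_bound s; rewrite ler_norml => /andP[].
rewrite sumr_const card_ffun -[leLHS]mulr_natl natrX.
have cS : #|S|%:R ^+ #|V| <= expR (#|S|%:R * n) :> R.
  rewrite mulrC expRM_natl lerXn2r ?nnegrE ?expR_ge0 //.
  by apply: le_trans (expR_ge1Dx _); rewrite lerDr.
apply: le_trans (ler_wpM2r (expR_ge0 b) cS) _.
rewrite /boltz -!expRD ler_expR.
have S0 : 0 <= #|S|%:R :> R by [].
have p1 := ler_wpM2l S0 nn; have p2 := ler_wpM2l beta_ge0 nn.
rewrite /b in Hs *; move: p1 p2 Hs; lra.
Qed.

End Partition.

Lemma max_path_weight_ge0 (R : realType) (V : finType) (e : rel V) (alpha l : R) :
  0 <= max_path_weight e alpha l.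
Proof. exact: bigmax_ge_id. Qed.

Lemma hamiltonian_norm_le (R : realType) (S : finType) (h : S -> R) (g : S -> S -> R) b :
  hamiltonian_norm h g <= b -> (forall x, `|h x| <= b) /\ (forall x y, `|g x y| <= b).
Proof.
rewrite /hamiltonian_norm ge_max => /andP[hb gb]; split=> [x|x y].
  exact: le_trans (le_bigmax 0 (fun x => `|h x|) x) hb.
apply: le_trans gb.
apply: le_trans (le_bigmax 0 (fun x => \big[Num.max/0]_y `|g x y|) x).
exact: (le_bigmax 0 (fun y => `|g x y|) y).
Qed.

(** * Choice of the constants *)

Section Main.
Variables (R : realType) (a alpha t delta : R).
Hypotheses (a_gt0 : 0 < a) (alpha_gt0 : 0 < alpha) (delta_gt0 : 0 < delta).

(** The percolation parameter at which open paths of length [a * ln n] beat, with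
    room to spare, the [n ^ (delta / alpha)] self-avoiding paths. *)
Definition rho : R := expR (- ((delta / alpha + 6) / a)).
(** The bound on the norm of the Hamiltonian for which [edge_prob] is [rho]. *)
Definition Hmax : R := ln (1 + rho) / 4.
(** The Poincare constant of a ball is at most [n `^ block_exponent]. *)
Definition block_exponent : R :=
  2 * Hmax * (Num.truncn t).+1%:R * (delta / alpha).

Lemma Hmax_gt0 : 0 < Hmax.
Proof. by rewrite divr_gt0 // ln_gt0 // ltrDl expR_gt0. Qed.

Lemma edge_prob_Hmax : edge_prob Hmax = rho.
Proof.
rewrite /edge_prob /Hmax mulrCA divff // mulr1 lnK.
  by rewrite addrC addKr.
by rewrite posrE addr_gt0 ?expR_gt0.
Qed.

Variables (S : finType) (h : S -> R) (g : S -> S -> R).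
Hypothesis gsym : forall x y, g x y = g y x.
Hypothesis Hle : hamiltonian_norm h g <= Hmax.
Variables (V : finType) (e : rel V).
Hypotheses (esym : symmetric e) (eirr : irreflexive e).
Local Notation n := (#|V|%:R : R).
Local Notation l := (a * ln n).
Hypothesis excess : forall v, (tree_excess e (ball_vertices e v l))%:~R <= t.
Hypothesis weight : max_path_weight e alpha l < delta * ln n.
Local Notation w := (boltz e h g).

Let h_le : forall x, `|h x| <= Hmax. Proof. by case: (hamiltonian_norm_le Hle). Qed.
Let g_le : forall x y, `|g x y| <= Hmax. Proof. by case: (hamiltonian_norm_le Hle). Qed.

Lemma ln_card_gt0 : 0 < ln n.
Proof. by rewrite -(pmulr_rgt0 _ delta_gt0) (le_lt_trans (max_path_weight_ge0 _ _ _) weight). Qed.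

Lemma card_ge2 : (2 <= #|V|)%N.
Proof. by have := ln_card_gt0; case: #|V| => [|[|//]]; rewrite ?ln1 ?ltxx // ln0 ?ltxx. Qed.

Let l_ge0 : 0 <= l. Proof. by rewrite mulr_ge0 // ltW // ln_card_gt0. Qed.

(** The block around [v]: the ball of radius [a * ln n]. *)
Definition ball v := ball_vertices e v l.

Lemma block_poincare_ball v (U : {set V}) f :
  bvar w (ball v :\: U) f <= expR (block_exponent * ln n) * \sum_u bvar w [set u] f.
Proof.
have D0 : 0 <= delta / alpha by rewrite ltW // divr_gt0.
have DL : 0 <= delta / alpha * ln n by rewrite mulr_ge0 // ltW // ln_card_gt0.
pose M := Num.truncn (delta / alpha * ln n).
have nt : (#|nontree_edges e v l| <= Num.truncn t)%N.
  have := excess v; rewrite -(card_nontree e v l_ge0) -pmulrn => nt.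
  by rewrite truncn_ge_nat // (le_trans _ nt).
have pd x : x \in ball_vertices e v l -> (anc_deg e v x + deg e x <= M)%N.
  move=> xB; rewrite truncn_ge_nat //.
  have h1 := le_lt_trans (anc_deg_weight eirr alpha_gt0 l_ge0 xB) weight.
  by rewrite mulrAC ler_pdivlMr // mulrC ltW.
have -> : ball v :\: U = ~: U :&: ball v by rewrite setDE setIC.
apply: le_trans (bvar_ball h esym (ltW Hmax_gt0) g_le l_ge0 nt f (~: U) pd) _.
apply: ler_wpM2r; first by apply: sumr_ge0 => u _; apply: bvar_ge0 => s; exact: boltz_gt0.
rewrite /peel_factor -expRM_natr ler_expR /block_exponent.
move: Hmax (ltW Hmax_gt0) => H H0; rewrite -[leRHS]mulrA ler_wpM2l ?truncn_le //.
by rewrite !mulr_ge0.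
Qed.

Lemma far_ball v q : path e v q -> last v q \notin ball v ->
  ((Num.truncn l).+1 <= size q)%N.
Proof.
move=> pq; have cq : connect e v (last v q) by apply/connectP; exists q.
rewrite /ball in_set (sym_connect_sym esym) cq /= -ltNge => far.
rewrite truncn_lt_nat // (lt_le_trans far) // ler_nat (gdist_sym esym).
exact: gdist_walk.
Qed.

(** The influence of the exterior of a ball on its centre: [2 n ^ (-6)]. *)
Definition decay_rate : R := 2 * expR (- (6 * ln n)).

Lemma decay_ball v (U : {set V}) s s' (phi : S -> R) (M : R) : agree U s s' ->
  (forall x, `|phi x| <= M) ->
  ce w (ball v :\: U) (fun t => phi (t v)) s - ce w (ball v :\: U) (fun t => phi (t v)) s'
  <= decay_rate * M.
Proof.
move=> /agreeP ss' phiM.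
have M0 : 0 <= M by apply: le_trans (phiM (s v)).
pose L := (Num.truncn l).+1.
have := @site_decay R V S e h g esym eirr gsym Hmax g_le v (ball v) L (saws e L v) _ _ _
  (ball v :\: U) s s' phi M _ phiM.
move=> /(_ _ _ _ _)/le_trans; apply.
- move=> q pq uq sq; by rewrite mem_filter uq mem_walks pq sq eqxx.
- by move=> q; rewrite mem_filter mem_walks => /and3P[-> _ /eqP].
- by move=> q; exact: far_ball.
- by move=> u; rewrite in_setD negb_and negbK => /orP[/ss'//|/negbTE->].
rewrite /decay_rate [leRHS]mulrAC ler_wpM2l ?mulr_ge0 //.
rewrite /decay_bound edge_prob_Hmax.
apply: (@le_trans _ _ (expR (delta / alpha * ln n) * expR (- ((delta / alpha + 6) * ln n)))).
  apply: ler_pM; rewrite ?exprn_ge0 ?expR_ge0 //.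
    have tl : (Num.truncn l)%:R <= l by rewrite truncn_le.
    apply: le_trans (saw_count_weight eirr alpha_gt0 v tl) _.
    by rewrite ler_expR mulrAC ler_wpM2r ?invr_ge0 ?ltW.
  rewrite /rho -expRM_natr ler_expR mulNr lerN2.
  rewrite -[leLHS](_ : (delta / alpha + 6) / a * l = _); last by field; rewrite !gt_eqF.
  apply: ler_wpM2l; last by rewrite ltW // truncnS_gt.
  by rewrite ltW // divr_gt0 // addr_gt0 // divr_gt0.
by rewrite -expRD ler_expR; lra.
Qed.

Lemma decay_rate_small : n * decay_rate <= 8^-1.
Proof.
have n2 : 2 <= n by rewrite ler_nat card_ge2.
have n0 : 0 < n by lra.
rewrite /decay_rate expRN expRM_natl lnK ?posrE //.
have -> : n * (2 * (n ^+ 6)^-1) = 2 * (n ^+ 5)^-1 by field; rewrite gt_eqF.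
rewrite ler_pdivrMr ?exprn_gt0 // mulrC ler_pdivlMr //.
have h5 : 2 ^+ 5 <= n ^+ 5 by rewrite lerXn2r ?nnegrE // ltW.
lra.
Qed.

(** The Poincare constant of the chain is [4 n kap], with [kap] that of the balls,
    and the logarithm of the smallest stationary probability is of order
    [n ^ 2]. *)
Lemma gibbs_mixing :
  (mixing_time (gibbs_sampler e h g) (gibbs_measure e h g)
    <= (4 * (4 * Hmax + #|S|%:R + 3) * n `^ (4 + block_exponent))%:E)%E.
Proof.
have n2 : 2 <= n by rewrite ler_nat card_ge2.
have V0 : (0 < #|V|)%N := ltnW card_ge2.
have b0 := ltW Hmax_gt0.
have be0 : 0 <= block_exponent.
  rewrite /block_exponent; move: Hmax b0 => H H0.
  by rewrite !mulr_ge0 ?invr_ge0 //; exact: ltW.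
pose kap := expR (block_exponent * ln n).
have kap1 : 1 <= kap.
  by rewrite -expR0 ler_expR mulr_ge0 // ltW // ln_card_gt0.
have c1 : 1 <= 4 * n * kap by nra.
pose A := (4 * Hmax + #|S|%:R) * n ^+ 2.
have B0 : 0 <= 4 * Hmax + #|S|%:R by apply: addr_ge0 => //; apply: mulr_ge0.
have A0 : 0 <= A by rewrite mulr_ge0 ?exprn_ge0.
have Z s := @partition_bound R V S e h g Hmax b0 h_le g_le s V0.
have P f (f0 : \sum_s w s * f s = 0) := poincare (@boltz_gt0 R V S e h g) decay_ball
  block_poincare_ball f0 decay_rate_small.
apply: le_trans (mixing_time_bound esym eirr gsym V0 c1 P A0 Z) _.
rewrite lee_fin.
have -> : n `^ (4 + block_exponent) = n ^+ 4 * kap.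
  rewrite powRD; last by apply/implyP => _; rewrite pnatr_eq0 -lt0n.
  by rewrite (powR_mulrn 4) // /kap /powR pnatr_eq0 gtn_eqF.
rewrite /A; move: (4 * Hmax + _) B0 => B B0.
have n21 : 1 <= n ^+ 2 by rewrite exprn_ege1 //; lra.
have k0 : 0 <= kap by lra.
apply: (@le_trans _ _ (4 * n ^+ 2 * kap * (B * n ^+ 2 + 3 * n ^+ 2))).
  rewrite (_ : n * (4 * n * kap) = 4 * n ^+ 2 * kap); last by ring.
  rewrite ler_wpM2l ?mulr_ge0 ?exprn_ge0 // lerD2l; lra.
by rewrite le_eqVlt; apply/orP; left; apply/eqP; ring.
Qed.

End Main.

Theorem theorem6 (R : realType) (a alpha t delta : R)
    (a_gt0 : 0 < a) (alpha_gt0 : 0 < alpha) (t_gt0 : 0 < t)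
    (delta_gt0 : 0 < delta) :
  exists Hstar C : R, 0 < Hstar /\
    forall (S : finType) (h : S -> R) (g : S -> S -> R),
      (forall x y, g x y = g y x) ->
      hamiltonian_norm h g <= Hstar ->
      exists K : R,
        forall (V : finType) (e : rel V),
          symmetric e -> irreflexive e ->
          (forall v, (tree_excess e (ball_vertices e v (a * ln #|V|%:R)))%:~R
                     <= t) ->
          max_path_weight e alpha (a * ln #|V|%:R) < delta * ln #|V|%:R ->
          (mixing_time (gibbs_sampler e h g) (gibbs_measure e h g)
             <= (K * #|V|%:R `^ C)%:E)%E.
Proof.
exists (Hmax a alpha delta), (4 + block_exponent a alpha t delta).
split=> [|S h g gsym Hle]; first exact: Hmax_gt0.
exists (4 * (4 * Hmax a alpha delta + #|S|%:R + 3)) => V e esym eirr excess weight.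
exact: gibbs_mixing.
Qed.
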